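(* Let $q$ and $n$ be positive integers with $q\ge n$. Let the tropical holomorphic curve $f:\mathbb{R}\to\mathbb{TP}^n$ be tropical linearly nondegenerate. Assume that $V_{P_j}$ are tropical hyperplanes in $\mathbb{TP}^n$ defined by homogeneous tropical polynomials $P_j$ $(j=1,\dots,q)$ of degree $1$, respectively. Let $$L=\bigl[(P_1\circ f)\odot(P_2\circ f)\odot\cdots\odot(P_q\circ f)\bigr]\oslash C_o(P_1\circ f,\dots,P_{n+1}\circ f).$$ If $\lambda=\mathrm{ddg}(\{P_{n+2}\circ f,\dots,P_q\circ f\})$ and $$\limsup_{r\to\infty}\frac{\log T_f(r)}{r}=0,$$ then \begin{align*} (q-n-1-\lambda)T_f(r)&\le N(r,1_o\oslash L)-N(r,L)+o(T_f(r))\\ &=\sum_{j=1}^{q}N\bigl(r,1_o\oslash(P_j\circ f)\bigr)-N\bigl(r,1_o\oslash C_o(P_1\circ f,\dots,P_{n+1}\circ f)\bigr)+o(T_f(r))\\ &\le\sum_{j=n+2}^{q}N\bigl(r,1_o\oslash(P_j\circ f)\bigr)+o(T_f(r))\\ &\le(q-n-1)T_f(r)+o(T_f(r)), \end{align*} where $r$ approaches infinity outside an exceptional set of zero upper density measure. In the special case $\lambda=0$, \begin{align*} (q-n-1)T_f(r)&=N(r,1_o\oslash L)-N(r,L)+o(T_f(r))\\ &=\sum_{j=1}^{q}N\bigl(r,1_o\oslash(P_j\circ f)\bigr)-N\bigl(r,1_o\oslash C_o(P_1\circ f,\dots,P_{n+1}\circ f)\bigr)+o(T_f(r))\\ &=\sum_{j=n+2}^{q}N\bigl(r,1_o\oslash(P_j\circ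 f)\bigr)+o(T_f(r)), \end{align*} where $r$ approaches infinity outside an exceptional set of zero upper density measure.
   Context: Tropical semiring: $\mathbb{R}_{\max}=\mathbb{R}\cup\{-\infty\}$ with $x\oplus y=\max(x,y)$, $x\odot y=x+y$, $x\oslash y=x-y$, $x^{\odot a}=ax$, $0_o=-\infty$, $1_o=0$. $\mathbb{TP}^n$ is $\mathbb{R}_{\max}^{n+1}\setminus\{(0_o,\dots,0_o)\}$ modulo $(a_0,\dots,a_n)\sim(\mu+a_0,\dots,\mu+a_n)$, $\mu\in\mathbb{R}$. A tropical meromorphic function is a continuous piecewise linear $f:\mathbb{R}\to\mathbb{R}$ (possibly infinitely many pieces, derivative discontinuities locally finite). With $\omega_f(x)=\lim_{\varepsilon\to0+}\{f'(x+\varepsilon)-f'(x-\varepsilon)\}$, $x$ is a zero of multiplicity $\omega_f(x)$ if $\omega_f(x)>0$ and a pole of multiplicity $-\omega_f(x)$ if $\omega_f(x)<0$. A tropical entire function is a tropical meromorphic function without poles (equivalently, convex). $n(r,f)$ is the number of poles of $f$ in $(-r,r)$ counted with multiplicity, and $N(r,f)=\frac12\int_0^r n(t,f)\,dt$. So $N(r,1_o\oslash h)$, where $1_o\oslash h=-h$, counts the zeros of $h$. A tropical holomorphic curve $f=[f_0:\dots:f_n]:\mathbb{R}\to\mathbb{TP}^n$ is given by a reduced representation $(f_0,\dots,f_n)$ of tropical entire functions with no zero common to all of them. With $\|f(x)\|=\max_j f_j(x)$, $T_f(r)=\frac12[\|f(r)\|+\|f(-r)\|]-\|f(0)\|$ (independent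 of the reduced representation). A homogeneous tropical polynomial of degree $1$ is $P(x)=\bigoplus_{k=0}^n c_k\odot x_k$ with $c_k\in\mathbb{R}_{\max}$ not all $0_o$; the tropical hyperplane $V_P$ is the set of points at which the maximum defining $P$ is attained by at least two monomials. $P\circ f=P(f_0,\dots,f_n)$. $f$ is tropical linearly nondegenerate if $f(\mathbb{R})\not\subset V_P$ for every tropical hyperplane $V_P$ in $\mathbb{TP}^n$. For $F=\bigoplus_{k=0}^n a_k\odot f_k$, $a_k\in\mathbb{R}_{\max}$, not identically $0_o$, $\ell(F)$ is the smallest $j\in\{1,\dots,n+1\}$ such that $F=\bigoplus_{i=1}^j b_i\odot f_{k_i}$ for some $0\le k_1<\dots<k_j\le n$ and real $b_i$. $F$ is complete if $\ell(F)=n+1$. The degree of degeneracy $\mathrm{ddg}(Q)$ of a collection $Q$ of such $F$ is the number of non-complete elements of $Q$ (here the elements are indexed by $j=n+2,\dots,q$). Fix $c\in\mathbb{R}\setminus\{0\}$. The tropical Casoratian of $g_0,\dots,g_n$ is $C_o(g_0,\dots,g_n)(x)=\max_\pi\sum_{k=0}^n g_k(x+\pi(k)c)$, the maximum over all permutations $\pi$ of $\{0,\dots,n\}$. The statement involves $P_1,\dots,P_{n+1}$ and so presupposes $q\ge n+1$. A set $E$ has zero upper density measure if $\limsup_{r\to\infty}\frac1r\int_{E\cap[1,r]}dt=0$. *)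

(* Defs.v *)
From HB Require Import structures.
From mathcomp Require Import all_boot all_order all_algebra.
From mathcomp Require Import perm generic_quotient.
From mathcomp Require Import all_classical all_reals all_analysis.

Set Implicit Arguments.
Unset Strict Implicit.
Unset Printing Implicit Defensive.

Import Order.TTheory GRing.Theory Num.Theory.
Import numFieldNormedType.Exports.

Local Open Scope classical_set_scope.
Local Open Scope ring_scope.
Local Open Scope quotient_scope.

(** Tropical arithmetic is written with the ordinary operations: [(+)] is [max],
    [(.)] is [+], [(/)] is [-], [0_o] is [-oo] and [1_o] is [0]. *)

(** [R_max] is [\bar R] without [+oo]. A [tcoord R n] is a vector of
    [R_max^(n+1)] other than [(-oo, ..., -oo)]. These vectors are both the
    homogeneous coordinates of points and the coefficient vectors of tropical
    linear forms. *)
Definition is_tcoord (R : realType) (n : nat)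
    (a : {ffun 'I_n.+1 -> \bar R}) : bool :=
  [forall k, a k != +oo%E] && [exists k, a k != -oo%E].

Definition tcoord (R : realType) (n : nat) :=
  {a : {ffun 'I_n.+1 -> \bar R} | is_tcoord a}.

Lemma is_tcoord_EFin (R : realType) (n : nat) (a : 'I_n.+1 -> R) :
  is_tcoord [ffun k => (a k)%:E].
Proof.
by apply/andP; split; [apply/forallP=> k | apply/existsP; exists ord0];
  rewrite ffunE.
Qed.

Definition tcoord_of (R : realType) (n : nat) (a : 'I_n.+1 -> R) : tcoord R n :=
  exist (@is_tcoord R n) _ (is_tcoord_EFin a).

Definition tproj_rel (R : realType) (n : nat) : rel (tcoord R n) :=
  fun a b => `[< exists mu : R, forall k, val b k = (mu%:E + val a k)%E >].

Lemma tproj_rel_refl (R : realType) (n : nat) : reflexive (@tproj_rel R n).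
Proof. by move=> a; apply/asboolP; exists 0 => k; rewrite add0e. Qed.

Lemma tproj_rel_imp (R : realType) (n : nat) (a b : tcoord R n) :
  tproj_rel a b -> tproj_rel b a.
Proof.
move=> /asboolP[mu ab]; apply/asboolP; exists (- mu) => k.
by rewrite ab addeA -EFinD addNr add0e.
Qed.

Lemma tproj_rel_sym (R : realType) (n : nat) : symmetric (@tproj_rel R n).
Proof. by move=> a b; apply/idP/idP; apply: tproj_rel_imp. Qed.

Lemma tproj_rel_trans (R : realType) (n : nat) : transitive (@tproj_rel R n).
Proof.
move=> b a d /asboolP[mu ab] /asboolP[nu bd]; apply/asboolP.
by exists (nu + mu) => k; rewrite bd ab addeA EFinD.
Qed.

Canonical tproj_equiv (R : realType) (n : nat) :=
  EquivRel (@tproj_rel R n) (@tproj_rel_refl R n) (@tproj_rel_sym R n)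
    (@tproj_rel_trans R n).

Definition TP (R : realType) (n : nat) := {eq_quot (@tproj_rel R n)}.

(** The class [[a_0 : ... : a_n]]. *)
Definition tpoint (R : realType) (n : nat) (a : tcoord R n) : TP R n :=
  \pi_(TP R n) a.

Lemma tpoint_eq (R : realType) (n : nat) (a b : tcoord R n) :
  tpoint a = tpoint b <->
  exists mu : R, forall k, val b k = (mu%:E + val a k)%E.
Proof.
split=> [/eqP|ab]; first by rewrite /tpoint piE => /asboolP.
by apply/eqP; rewrite /tpoint piE; apply/asboolP.
Qed.

Definition tform (R : realType) (n : nat) (c x : tcoord R n) : \bar R :=
  \big[maxe/-oo%E]_(k < n.+1) (val c k + val x k)%E.

Definition max_attained_twice (R : realType) (n : nat) (c x : tcoord R n) :=
  exists k l : 'I_n.+1, [/\ k != l,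
    (val c k + val x k)%E = tform c x & (val c l + val x l)%E = tform c x].

Definition thyperplane (R : realType) (n : nat) (c : tcoord R n) :
    set (TP R n) :=
  [set p | max_attained_twice c (repr p)].

Lemma tformD (R : realType) (n : nat) (c a b : tcoord R n) (mu : R) :
  (forall k, val b k = (mu%:E + val a k)%E) ->
  tform c b = (mu%:E + tform c a)%E.
Proof.
move=> ab; rewrite /tform.
have -> : (mu%:E + \big[maxe/-oo]_(k < n.+1) (val c k + val a k))%E
    = (\big[maxe/-oo]_(k < n.+1) (mu%:E + (val c k + val a k)))%E.
  by apply: (big_morph (fun x => mu%:E + x)%E) => [x y|//]; exact: adde_maxr.
by apply: eq_bigr => k _; rewrite ab addeCA.
Qed.

(** Membership does not depend on the choice of homogeneous coordinates. *)
Lemma thyperplaneP (R : realType) (n : nat) (c a : tcoord R n) :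
  thyperplane c (tpoint a) <-> max_attained_twice c a.
Proof.
have tr (x y : tcoord R n) : tpoint x = tpoint y ->
    max_attained_twice c x -> max_attained_twice c y.
  move=> /tpoint_eq[mu xy] [k [l [kl hk hl]]]; exists k, l; split=> //.
    by rewrite (tformD c xy) xy addeCA hk.
  by rewrite (tformD c xy) xy addeCA hl.
have e : tpoint (repr (tpoint a)) = tpoint a by exact: reprK.
by split; [exact: tr e | exact: tr (esym e)].
Qed.

Definition tropical_meromorphic (R : realType) (f : R -> R) : Prop :=
  continuous f /\
  exists D : set R, (forall a b : R, finite_set (D `&` `[a, b])) /\
    forall x, ~ D x -> exists a b : R, \forall y \near x, f y = a * y + b.

Definition omega (R : realType) (f : R -> R) (x : R) : R :=
  lim ((derive1 f (x + e) - derive1 f (x - e)) @[e --> 0^'+]).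

Definition tropical_entire (R : realType) (f : R -> R) : Prop :=
  tropical_meromorphic f /\ forall x, ~ omega f x < 0.

(** The sum is finite for a tropical meromorphic [f]. *)
Definition npoles (R : realType) (f : R -> R) (r : R) : R :=
  \sum_(x \in [set x | - r < x < r /\ omega f x < 0]) - omega f x.

Definition Ncount (R : realType) (r : R) (f : R -> R) : R :=
  2^-1 * \int[@lebesgue_measure R]_(t in `[0, r]) npoles f t.

Definition reduced_representation (R : realType) (n : nat)
    (f : R -> TP R n) (fr : 'I_n.+1 -> R -> R) : Prop :=
  [/\ forall j, tropical_entire (fr j),
      ~ (exists x, forall j, 0 < omega (fr j) x) &
      forall x, f x = tpoint (tcoord_of (fun j => fr j x))].

(** The starting value of the iterated maximum is one of its terms. *)
Definition tnorm (R : realType) (n : nat) (fr : 'I_n.+1 -> R -> R) (x : R) : R :=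
  \big[Num.max/fr ord0 x]_(j < n.+1) fr j x.

Definition Tchar (R : realType) (n : nat) (fr : 'I_n.+1 -> R -> R) (r : R) : R :=
  2^-1 * (tnorm fr r + tnorm fr (- r)) - tnorm fr 0.

Definition linearly_nondegenerate (R : realType) (n : nat) (f : R -> TP R n) :=
  forall c : tcoord R n, ~ (range f `<=` thyperplane c).

(** [P o f = P(f_0, ..., f_n)]; the maximum is finite, since the [fr k] are
    real valued and some coefficient of [c] is real. *)
Definition tform_comp (R : realType) (n : nat) (c : tcoord R n)
    (fr : 'I_n.+1 -> R -> R) (x : R) : R :=
  fine (tform c (tcoord_of (fun k => fr k x))).

(** [F] is the maximum of [b_i + f_(k_i)], [i < j], with [k] increasing. *)
Definition combination_of_length (R : realType) (n : nat)
    (fr : 'I_n.+1 -> R -> R) (F : R -> R) (j : nat) : Prop :=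
  exists (k : 'I_j -> 'I_n.+1) (b : 'I_j -> R),
    (forall i1 i2 : 'I_j, (i1 < i2)%N -> (k i1 < k i2)%N) /\
    forall x, (F x)%:E = \big[maxe/-oo%E]_(i < j) (b i + fr (k i) x)%:E.

(** The least such [j] in [{1, ..., n+1}]; one exists whenever [F] is a tropical
    linear combination of the [fr k], so the default value plays no role. *)
Definition ell (R : realType) (n : nat) (fr : 'I_n.+1 -> R -> R)
    (F : R -> R) : nat :=
  \big[minn/n.+1]_(1 <= j < n.+2 | `[< combination_of_length fr F j >]) j.

Definition tcomplete (R : realType) (n : nat) (fr : 'I_n.+1 -> R -> R)
    (F : R -> R) : bool :=
  ell fr F == n.+1.

Definition ddg (R : realType) (n : nat) (fr : 'I_n.+1 -> R -> R)
    (I : finType) (A : {set I}) (Q : I -> R -> R) : nat :=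
  #|[set j in A | ~~ tcomplete fr (Q j)]|.

(** The starting value of the iterated maximum is the term of the identity. *)
Definition casoratian (R : realType) (n : nat) (c : R)
    (g : 'I_n.+1 -> R -> R) (x : R) : R :=
  \big[Num.max/(\sum_(k < n.+1) g k (x + k%:R * c))]_(s : 'S_n.+1)
    \sum_(k < n.+1) g k (x + (s k)%:R * c).

Definition zero_upper_density (R : realType) (E : set R) : Prop :=
  measurable E /\
  limf_esup (fun r : R =>
    (r^-1%:E * \int[@lebesgue_measure R]_(t in E `&` `[1%R, r]) 1)%E)
    (pinfty_nbhs R) = 0%E.

(** The filter of [r --> +oo] with [r] outside [E]. *)
Definition pinfty_outside (R : realType) (E : set R) : filter_on R :=
  FilterType (within (~` E) (pinfty_nbhs R)) (within_filter _ _).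

(* Main.v *)
Require Import Defs.
From mathcomp Require Import all_boot all_order all_algebra.
From mathcomp Require Import all_classical all_reals all_analysis.
From mathcomp Require Import perm measurable_realfun ring lra.

Set Implicit Arguments.
Unset Strict Implicit.
Unset Printing Implicit Defensive.

Import Order.TTheory GRing.Theory Num.Theory.
Import numFieldNormedType.Exports.
Local Open Scope classical_set_scope.
Local Open Scope ring_scope.

(** Write [J g r = (g r + g (- r)) / 2 - g 0]. The tropical Jensen formula
    [N(r, - g) - N(r, g) = J g r] turns every counting function into such a mean,
    so the two middle expressions of the chain are both equal to
    [sum_(j > n) J(P_j o f) + Delta], where [Delta = sum_(j <= n) J(P_j o f) - J(Co)].
    Always [0 <= J(P_j o f) <= T + O(1)], and a complete [P_j o f] has only real
    coefficients, hence differs from [||f||] by a bounded function and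
    [J(P_j o f) = T + O(1)]; bounded terms are [o(T)] because nondegeneracy
    forces [T] to grow at least linearly. Each term of the Casoratian differs from
    [sum_(j <= n) P_j o f] by translations of length at most [n |c|], and for a
    convex [g] such a translation at [r] or [- r] costs at most
    [2 (J g (r + H) - J g r) + O(1)]. So [|Delta|] is bounded by an increment of a
    nondecreasing function [U] of subexponential growth, and such increments are
    [o(U)] outside a set of zero upper density. *)

(** * Piecewise linear functions and the tropical Jensen formula *)

(** [a] is the mean of the two one-sided slopes at [x] and [w] half of their difference, so kinks
    add and scale linearly. *)
Definition kink (R : realType) (f : R -> R) (x w : R) : Prop :=
  exists a d : R, 0 < d /\
    forall y, `|y - x| < d -> f y = f x + a * (y - x) + w * `|y - x|.

(** A purely local condition, inherited directly by sums, translates and maxima; breakpoints are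
    collected into a finite list only later, by compactness. *)
Definition piecewise_linear (R : realType) (f : R -> R) : Prop :=
  forall x, exists w, kink f x w.

Lemma kinkD (R : realType) (f g : R -> R) (x v w : R) :
  kink f x v -> kink g x w -> kink (fun y => f y + g y) x (v + w).
Proof.
move=> [a [d [d0 fE]]] [b [e [e0 gE]]]; exists (a + b), (Num.min d e).
split=> [|y]; first by rewrite lt_min d0.
by rewrite lt_min => /andP[yd ye]; rewrite fE// gE//; ring.
Qed.

Lemma kinkZ (R : realType) (f : R -> R) (x k w : R) :
  kink f x w -> kink (fun y => k * f y) x (k * w).
Proof.
move=> [a [d [d0 fE]]]; exists (k * a), d; split=> // y yd.
by rewrite fE//; ring.
Qed.

Lemma kinkN (R : realType) (f : R -> R) (x w : R) :
  kink f x w -> kink (\- f) x (- w).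
Proof.
move=> [a [d [d0 fE]]]; exists (- a), d; split=> // y yd /=.
by rewrite fE//; ring.
Qed.

Lemma kink_abs_sub (R : realType) (p x : R) :
  kink (fun y => `|y - p|) x (if x == p then 1 else 0).
Proof.
case: eqVneq => [->|xp].
  by exists 0, 1; split=> // y _; rewrite subrr normr0; ring.
have [xp'|px|E] := ltgtP x p; last by rewrite E eqxx in xp.
- exists (-1), (p - x); split=> [|y]; first by rewrite subr_gt0.
  rewrite ltr_norml => /andP[_ yx].
  by rewrite (ler0_norm (x := y - p)) ?(ler0_norm (x := x - p)); lra.
- exists 1, (x - p); split=> [|y]; first by rewrite subr_gt0.
  rewrite ltr_norml => /andP[yx _].
  by rewrite (ger0_norm (x := y - p)) ?(ger0_norm (x := x - p)); lra.
Qed.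

(** At a zero of [f] the one-sided slopes [a + w] and [a - w] become [|a + w|] and [- |a - w|];
    elsewhere [f] keeps its sign near [x]. *)
Lemma kink_norm (R : realType) (f : R -> R) (x w : R) :
  kink f x w -> exists v, kink (fun y => `|f y|) x v.
Proof.
move=> [a [d [d0 fE]]].
have [f0|f0] := eqVneq (f x) 0.
  exists ((`|a + w| + `|a - w|) / 2), ((`|a + w| - `|a - w|) / 2), d.
  split=> // y yd; rewrite fE// f0 normr0.
  have [xy|yx] := leP x y.
    have -> : 0 + a * (y - x) + w * `|y - x| = (a + w) * (y - x).
      by rewrite ger0_norm ?subr_ge0//; ring.
    by rewrite normrM (ger0_norm (x := y - x)) ?subr_ge0//; field.
  have -> : 0 + a * (y - x) + w * `|y - x| = (a - w) * (y - x).
    by rewrite ltr0_norm ?subr_lt0//; ring.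
  by rewrite normrM (ltr0_norm (x := y - x)) ?subr_lt0//; field.
(* A Lipschitz constant near [x]; the added 1 keeps it positive, so that [|f x| / K] is a legitimate
   radius. *)
pose K := `|a| + `|w| + 1.
have K0 : 0 < K by rewrite /K ltr_wpDl// addr_ge0.
have small y : `|y - x| < Num.min d (`|f x| / K) -> f y = f x + a * (y - x) + w * `|y - x|
    /\ `|a * (y - x) + w * `|y - x| | < `|f x|.
  rewrite lt_min ltr_pdivlMr// => /andP[yd yK]; split; first exact: fE.
  apply: le_lt_trans yK.
  apply: (le_trans (ler_normD _ _)); rewrite !normrM normr_id -mulrDl mulrC.
  by apply: ler_wpM2l => //; rewrite /K lerDl.
have m0 : 0 < Num.min d (`|f x| / K) by rewrite lt_min d0 divr_gt0// normr_gt0.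
have [fx|fx|E] := ltgtP (f x) 0; last by rewrite E eqxx in f0.
- exists (- w), (- a), (Num.min d (`|f x| / K)); split=> // y /small[-> h].
  move: h; rewrite (ltr0_norm fx) ltr_norml => /andP[h1 h2].
  by rewrite ltr0_norm; lra.
- exists w, a, (Num.min d (`|f x| / K)); split=> // y /small[-> h].
  move: h; rewrite (gtr0_norm fx) ltr_norml => /andP[h1 h2].
  by rewrite gtr0_norm; lra.
Qed.

Lemma piecewise_linearD (R : realType) (f g : R -> R) :
  piecewise_linear f -> piecewise_linear g ->
  piecewise_linear (fun x => f x + g x).
Proof.
by move=> hf hg x; have [v kv] := hf x; have [w kw] := hg x;
  exists (v + w); exact: kinkD.
Qed.

Lemma piecewise_linearN (R : realType) (f : R -> R) :
  piecewise_linear f -> piecewise_linear (\- f).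
Proof. by move=> hf x; have [v kv] := hf x; exists (- v); exact: kinkN. Qed.

Lemma piecewise_linear_max (R : realType) (f g : R -> R) :
  piecewise_linear f -> piecewise_linear g ->
  piecewise_linear (fun x => Num.max (f x) (g x)).
Proof.
move=> hf hg x.
have -> : (fun x => Num.max (f x) (g x))
    = (fun x => 2^-1 * (f x + g x + `|f x + (- g x)|)).
  by apply/funext => y; rewrite maxr_absE mulrC.
have [u ku] := piecewise_linearD hf (piecewise_linearN hg) x.
have [v kv] := kink_norm ku.
have [w kw] := piecewise_linearD hf hg x.
by exists (2^-1 * (w + v)); exact: kinkZ (kinkD kw kv).
Qed.

Lemma piecewise_linear_shift (R : realType) (f : R -> R) (s : R) :
  piecewise_linear f -> piecewise_linear (fun x => f (x + s)).
Proof.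
move=> hf x; have [w [a [d [d0 fE]]]] := hf (x + s).
exists w, a, d; split=> // y yd.
have e : y + s - (x + s) = y - x by ring.
by rewrite fE e.
Qed.

Lemma piecewise_linear_cst (R : realType) (k : R) :
  piecewise_linear (fun=> k).
Proof. by move=> x; exists 0, 0, 1; split=> // y _; ring. Qed.

Lemma piecewise_linear_sum (R : realType) (I : Type) (s : seq I) (P : pred I)
    (g : I -> R -> R) :
  (forall i, P i -> piecewise_linear (g i)) ->
  piecewise_linear (fun x => \sum_(i <- s | P i) g i x).
Proof.
move=> hg; elim: s => [|i s IH].
  have -> : (fun x => \sum_(i <- [::] | P i) g i x) = fun=> 0.
    by apply/funext => x; rewrite big_nil.
  exact: piecewise_linear_cst.
have -> : (fun x => \sum_(j <- i :: s | P j) g j x)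
    = if P i then fun x => g i x + \sum_(j <- s | P j) g j x
      else fun x => \sum_(j <- s | P j) g j x.
  by case: ifP => Pi; apply/funext => x; rewrite big_cons Pi.
by case: ifP => [/hg hi|//]; exact: piecewise_linearD.
Qed.

Lemma derive1_affine_near (R : realType) (f : R -> R) (x a b : R) :
  (\forall y \near x, f y = a * y + b) -> derive1 f x = a.
Proof.
move=> fE; rewrite derive1E (near_eq_derive (g := fun y => a * y + b))//.
have : is_derive x 1 (fun y => a * y + b) a.
  apply: is_derive_eq; rewrite addr0; exact: mulr1.
by move=> h; rewrite derive_val.
Qed.

(** The derivative is [a + w] just right of [x] and [a - w] just left of it, so the expression under
    the limit is eventually constant. *)
Lemma omega_kink (R : realType) (f : R -> R) (x w : R) :
  kink f x w -> omega f x = 2 * w.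
Proof.
move=> [a [d [d0 fE]]]; rewrite /omega.
apply: lim_near_cst; first exact: norm_hausdorff.
near=> e.
have e0 : 0 < e by near: e; exact: nbhs_right_gt.
have ed : e < d by near: e; exact: nbhs_right_lt.
(* [s] is the sign of the side; the condition on the quotient puts [z] on the closed side of [x]
   that contains [y]. *)
have side (s y : R) : 0 < `|y - x| < d ->
    (forall z, 0 <= (z - x) / (y - x) -> `|z - x| = s * (z - x)) ->
    derive1 f y = a + s * w.
  move=> /andP[y0 yd] hs.
  apply: (@derive1_affine_near _ _ _ _ (f x - (a + s * w) * x)).
  have m0 : 0 < Num.min `|y - x| (d - `|y - x|) by rewrite lt_min y0 subr_gt0.
  apply: filterS (nbhsx_ballx y _ m0) => z; rewrite /ball/= lt_min distrC.
  move=> /andP[z1 z2]; rewrite fE; last first.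
    have -> : z - x = (z - y) + (y - x) by ring.
    by apply: (le_lt_trans (ler_normD _ _)); lra.
  rewrite hs; first ring.
  have y0' : y - x != 0 by rewrite -normr_gt0.
  have -> : (z - x) / (y - x) = 1 + (z - y) / (y - x) by field.
  have : `|(z - y) / (y - x)| < 1 by rewrite normrM normfV ltr_pdivrMr ?mul1r.
  by rewrite ltr_norml => /andP[]; lra.
rewrite (side 1 (x + e)); first rewrite (side (-1) (x - e)); first by ring.
- have -> : x - e - x = - e by ring.
  by rewrite normrN gtr0_norm// e0.
- move=> z; have -> : x - e - x = - e by ring.
  rewrite invrN mulrN oppr_ge0 pmulr_lle0 ?invr_gt0// => h.
  by rewrite ler0_norm//; ring.
- have -> : x + e - x = e by ring.
  by rewrite gtr0_norm// e0.
- move=> z; have -> : x + e - x = e by ring.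
  by rewrite pmulr_lge0 ?invr_gt0// => h; rewrite ger0_norm//; ring.
Unshelve. all: by end_near. Qed.

Lemma affine_near_inj (R : realType) (x a b a' b' : R) :
  (\forall y \near x, a * y + b = a' * y + b') -> a = a' /\ b = b'.
Proof.
move=> E; have aa' : a = a'.
  rewrite -(@derive1_affine_near _ (fun y => a * y + b) x a b) ?(derive1_affine_near E)//.
  by near=> y.
by split=> //; have := nbhs_singleton E; rewrite aa' => /addrI.
Unshelve. all: by end_near. Qed.

(** The set where [f] has a given affine germ is open and closed in the connected set [I]; closed
    because two affine maps that agree near one point are equal. *)
Lemma locally_affine_itv (R : realType) (f : R -> R) (I : set R) :
  is_interval I ->
  (forall x, I x -> exists a b, \forall y \near x, f y = a * y + b) ->
  exists a b, forall x, I x -> f x = a * x + b.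
Proof.
move=> Iitv floc.
have [[x0 Ix0]|I0] := pselect (I !=set0); last first.
  by exists 0, 0 => x Ix; case: I0; exists x.
have [a [b fx0]] := floc _ Ix0; exists a, b.
pose C := interior [set z | f z = a * z + b].
have : I `&` C = I.
  apply: ((connected_intervalP I).2 Iitv); first by exists x0.
    by exists C => //; exact: open_interior.
  exists (closure C); first exact: closed_closure.
  apply/seteqP; split=> [y [Iy Cy]|y [Iy Cy]]; split=> //.
    exact: subset_closure.
  have [a' [b' fy]] := floc _ Iy.
  have [z [Cz fz]] := Cy _ (nbhs_interior fy).
  have [aa bb] : a = a' /\ b = b'.
    apply: (@affine_near_inj _ z); near=> t.
    have <- : f t = a * t + b by near: t; exact: Cz.
    by near: t; exact: fz.
  by rewrite /C /interior/= aa bb.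
move=> IC x Ix; have : (I `&` C) x by rewrite IC.
by move=> [_ /nbhs_singleton].
Unshelve. all: by end_near. Qed.

(** Local finiteness isolates [x] from the other points of [D], connectedness gives one affine
    branch on each side, and continuity makes both branches take the value [f x]. *)
Lemma tropical_meromorphic_piecewise_linear (R : realType) (f : R -> R) :
  tropical_meromorphic f -> piecewise_linear f.
Proof.
move=> [fcont [D [Dfin floc]]] x.
have [d d0 hd] : exists2 d : R, 0 < d & forall y, D y -> `|y - x| < d -> y = x.
  have cl : closed ((D `&` `[x - 1, x + 1]) `\ x).
    by apply: compact_closed; [exact: Rhausdorff|apply: finite_compact; apply: finite_setD].
  have : nbhs x (~` ((D `&` `[x - 1, x + 1]) `\ x)).
    by apply: open_nbhs_nbhs; split; [exact: closed_openC|move=> [_]; apply].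
  rewrite -nbhs_ballE => -[e /= e0 he].
  exists (Num.min e 1); first by rewrite lt_min e0 ltr01.
  move=> y Dy; rewrite lt_min => /andP[ye]; rewrite ltr_norml => /andP[y1 y2].
  have := he y; rewrite /ball/= distrC => /(_ ye) h.
  apply: contrapT => yx; apply: h; split=> //; split=> //=.
  by rewrite in_itv/=; apply/andP; lra.
have itv (p q : R) : is_interval [set y | p < y < q].
  by move=> y z /= /andP[py _] /andP[_ zq] t /andP[yt tz]; apply/andP; lra.
have [a [b fr]] : exists a b, forall y, x < y < x + d -> f y = a * y + b.
  apply: (locally_affine_itv (itv _ _)) => y /= /andP[xy yd].
  apply: floc => Dy; have := hd y Dy; rewrite gtr0_norm ?subr_gt0//.
  move=> h; have E : y = x by apply: h; lra.
  by rewrite E ltxx in xy.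
have [a' [b' fl]] : exists a b, forall y, x - d < y < x -> f y = a * y + b.
  apply: (locally_affine_itv (itv _ _)) => y /= /andP[xy yd].
  apply: floc => Dy; have := hd y Dy; rewrite ltr0_norm ?subr_lt0//.
  move=> h; have E : y = x by apply: h; lra.
  by rewrite E ltxx in yd.
have er : f x = a * x + b.
  have h1 : f y @[y --> x^'+] --> f x.
    exact: cvg_at_right_filter (fcont x).
  have h2 : (a * y + b) @[y --> x^'+] --> a * x + b.
    apply: cvg_at_right_filter; apply: cvgD; last exact: cvg_cst.
    by apply: cvgM; [exact: cvg_cst|exact: cvg_id].
  apply: (cvg_unique _ h1); first exact: norm_hausdorff.
  apply: cvg_trans h2; apply: near_eq_cvg; near=> y.
  rewrite fr//; apply/andP; split; near: y.
    exact: nbhs_right_gt.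
  by apply: nbhs_right_lt; lra.
have el : f x = a' * x + b'.
  have h1 : f y @[y --> x^'-] --> f x.
    exact: cvg_at_left_filter (fcont x).
  have h2 : (a' * y + b') @[y --> x^'-] --> a' * x + b'.
    apply: cvg_at_left_filter; apply: cvgD; last exact: cvg_cst.
    by apply: cvgM; [exact: cvg_cst|exact: cvg_id].
  apply: (cvg_unique _ h1); first exact: norm_hausdorff.
  apply: cvg_trans h2; apply: near_eq_cvg; near=> y.
  rewrite fl//; apply/andP; split; near: y.
    by apply: nbhs_left_gt; lra.
  exact: nbhs_left_lt.
(* Half the slope jump and the mean slope; [a] belongs to the right branch and [a'] to the left
   one. *)
exists ((a - a') / 2), ((a + a') / 2), d; split=> // y.
have [xy|yx|->] := ltgtP x y.
- rewrite gtr0_norm ?subr_gt0// => yd.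
  rewrite fr; last by apply/andP; lra.
  by rewrite er; field.
- rewrite ltr0_norm ?subr_lt0// => yd.
  rewrite fl; last by apply/andP; lra.
  by rewrite el; field.
- by rewrite subrr normr0 => _; ring.
Unshelve. all: by end_near. Qed.

(** Each point has a ball in which [f] can bend only at the centre; finitely many such balls cover
    the segment, and their centres form [s]. *)
Lemma finite_kinks (R : realType) (f : R -> R) (r : R) : piecewise_linear f ->
  exists2 s : seq R, uniq s & forall x, - r <= x <= r -> x \notin s -> kink f x 0.
Proof.
move=> fPL.
have /choice[d hd] x : exists d : R, 0 < d /\
    forall y, `|y - x| < d -> y != x -> kink f y 0.
  have [w [a [d [d0 fE]]]] := fPL x; exists d; split=> // y yd yx.
    have := kink_abs_sub x y; rewrite (negbTE yx) => -[b [e [e0 gE]]].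
  exists (a + w * b), (Num.min e (d - `|y - x|)); split.
    by rewrite lt_min e0 subr_gt0.
  move=> z; rewrite lt_min => /andP[ze zd].
  have zxd : `|z - x| < d.
    have -> : z - x = (z - y) + (y - x) by ring.
    by apply: (le_lt_trans (ler_normD _ _)); lra.
  by rewrite (fE z zxd) (fE y yd) gE//; ring.
have := @segment_compact R (- r) r; rewrite compact_cover.
move=> /(_ R setT (fun x => ball x (d x))) []; first by move=> x _; exact: ball_open.
  move=> x _; exists x => //; apply: ballxx; exact: (hd x).1.
move=> D _ cov; exists (finmap.enum_fset D); first exact: finmap.fset_uniq.
move=> x xr xD.
have [|p pD] := cov x; first by rewrite /= in_itv.
rewrite /ball/= distrC => xp; apply: (hd p).2 => //.
by apply: contraNneq xD => ->.
Qed.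

Lemma kink0_affine (R : realType) (f : R -> R) (x : R) :
  kink f x 0 -> exists a b, \forall y \near x, f y = a * y + b.
Proof.
move=> [a [d [d0 fE]]]; exists a, (f x - a * x).
apply: filterS (nbhsx_ballx x _ d0) => y; rewrite /ball/= distrC => yd.
by rewrite fE//; ring.
Qed.

(** Subtracting [w |x - p|] straightens [f] at [p] and leaves every other kink unchanged, so the
    list is removed point by point; without kinks [f] is affine by connectedness. *)
Lemma piecewise_linear_repr (R : realType) (r : R) (s : seq R) (f : R -> R) :
  piecewise_linear f -> uniq s ->
  (forall x, - r < x < r -> x \notin s -> kink f x 0) ->
  exists a b, forall x, - r < x < r ->
    f x = a * x + b + \sum_(p <- s) omega f p / 2 * `|x - p|.
Proof.
elim: s f => [|p s IH] f fPL.
  move=> _ k0.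
  have [|x /= xr|a [b fE]] := @locally_affine_itv _ f [set x | - r < x < r].
  - by move=> y z /= /andP[py _] /andP[_ zq] t /andP[yt tz]; apply/andP; lra.
  - by apply: kink0_affine; apply: k0.
  - by exists a, b => x xr; rewrite big_nil addr0 fE.
rewrite cons_uniq => /andP[ps us] k0.
have [w kw] := fPL p.
pose g x := f x + (- w) * `|x - p|.
have kg x v : kink f x v -> kink g x (v + - w * (if x == p then 1 else 0)).
  by move=> kv; apply: kinkD => //; apply: kinkZ; exact: kink_abs_sub.
have [x|//|x xr xs|a [b gE]] := IH g.
- by have [v kv] := fPL x; eexists; apply: kg kv.
- have [->|xp] := eqVneq x p.
    by have := kg _ _ kw; rewrite eqxx mulr1 subrr.
  have := kg x 0; rewrite (negbTE xp) mulr0 addr0; apply; apply: k0 => //.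
  by rewrite inE negb_or xp.
- exists a, b => x xr; rewrite big_cons (omega_kink kw).
  have -> : \sum_(y <- s) omega f y / 2 * `|x - y|
      = \sum_(y <- s) omega g y / 2 * `|x - y|.
    apply: eq_big_seq => y ys.
    have yp : y != p by apply: contraNneq ps => <-.
    have [v kv] := fPL y.
    by rewrite (omega_kink kv) (omega_kink (kg _ _ kv)) (negbTE yp) mulr0 addr0.
  have E := gE x xr.
  have -> : f x = g x + w * `|x - p| by rewrite /g; ring.
  by rewrite E; field.
Qed.

(** A pole at [p] is counted by [n(t)] exactly when [t > |p|], which integrates over [[0, r]] to the
    weight [max(0, r - |p|)]. Points of [s] outside [(-r, r)] get weight 0. *)
Lemma Ncount_sum (R : realType) (r : R) (s : seq R) (f : R -> R) :
  0 <= r -> uniq s ->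
  (forall x, - r < x < r -> x \notin s -> omega f x = 0) ->
  Ncount r f = 2^-1 * \sum_(p <- s)
                        Num.max 0 (- omega f p) * Num.max 0 (r - `|p|).
Proof.
move=> r0 us o0; congr (_ * _).
have npE t : t <= r -> npoles f t
    = \sum_(p <- s) Num.max 0 (- omega f p) * \1_(`]`|p|, +oo[%classic) t.
  move=> tr; rewrite /npoles (fsbigE [seq p <- s | (`|p| < t) && (omega f p < 0)])/=.
  - rewrite big_filter_cond big_mkcond/=.
    apply: eq_bigr => p _; rewrite indicE/= mem_setE in_itv/= andbT.
    have -> : (p \in [set x | - t < x < t /\ omega f x < 0])
        = (`|p| < t) && (omega f p < 0).
      rewrite ltr_norml; apply/idP/andP => [|[pt op]]; last by rewrite inE.
      by rewrite inE => -[].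
    rewrite andbb; have [op|op] := ltP (omega f p) 0; last first.
      by rewrite max_l ?oppr_le0// mul0r andbF.
    rewrite andbT max_r ?oppr_ge0 ?ltW//.
    by case: ifP => _; rewrite ?mulr1 ?mulr0.
  - exact: filter_uniq.
  - by move=> p /=; rewrite mem_filter ltr_norml => /andP[/andP[]].
  - move=> p /= [pt op]; rewrite mem_filter ltr_norml pt op/= => /o0 E.
    by move: op; rewrite E ?ltxx//; move: pt => /andP[]; lra.
rewrite /Rintegral (@eq_integral _ _ _ (@lebesgue_measure R) _ (fun t => \sum_(p <- s)
   ((Num.max 0 (- omega f p))%:E * (\1_(`]`|p|, +oo[%classic) t)%:E))%E); last first.
  move=> t; rewrite inE/= in_itv/= => /andP[_ tr].
  by rewrite npE// -sumEFin.
have m0 x : (0 : R) <= Num.max 0 x by rewrite le_max lexx.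
rewrite ge0_integral_sum//=; last 2 first.
- move=> p; apply: measurable_funeM; apply/measurable_EFinP.
  exact: measurable_indic.
- by move=> p t op; rewrite -EFinM lee_fin mulr_ge0.
have -> : (\sum_(p <- s) \int[lebesgue_measure]_(t in `[0%R, r])
    ((Num.max 0 (- omega f p))%:E * (\1_(`]`|p|, +oo[%classic) t)%:E)
  = \sum_(p <- s) (Num.max 0 (- omega f p) * Num.max 0 (r - `|p|))%:E)%E.
  apply: eq_bigr => p _.
  rewrite ge0_integralZl_EFin//=; last by apply/measurable_EFinP; exact: measurable_indic.
  rewrite integral_indic//= EFinM; congr (_ * _)%E.
  have -> : `]`|p|, +oo[ `&` `[0, r] = `]`|p|, r]%classic.
    apply/seteqP; split=> t /=; rewrite !in_itv/= andbT.
      by move=> [-> /andP[_ ->]].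
    by move=> /andP[pt ->]; rewrite pt (le_trans _ (ltW pt)).
  rewrite lebesgue_measure_itv/= lte_fin; case: ltP => pr.
    by rewrite max_r ?subr_ge0 ?ltW.
  by rewrite max_l// subr_le0.
by rewrite sumEFin.
Qed.

Definition jensen_mean (R : realType) (f : R -> R) (r : R) : R :=
  2^-1 * (f r + f (- r)) - f 0.

(** The Jensen formula for a single corner: the mean is the weight of [p] in the counting
    function. *)
Lemma jensen_mean_abs_sub (R : realType) (p r : R) : 0 <= r ->
  jensen_mean (fun x => `|x - p|) r = Num.max 0 (r - `|p|).
Proof.
move=> r0; rewrite /jensen_mean sub0r normrN -opprD normrN.
case: (ger0P p) => p0.
  rewrite (ger0_norm (x := r + p)) ?addr_ge0//; case: (leP r p) => rp.
    by rewrite ler0_norm ?subr_le0// max_l ?subr_le0//; field.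
  by rewrite gtr0_norm ?subr_gt0// max_r ?subr_ge0 ?ltW//; field.
rewrite (ger0_norm (x := r - p)); last by lra.
case: (leP r (- p)) => rp.
  by rewrite ler0_norm ?max_l ?opprK; [field|lra..].
by rewrite ger0_norm ?max_r ?opprK; [field|lra..].
Qed.

(** The affine part of [f] has mean 0 and each kink contributes its jump times its counting weight.
    The positive part of the jump is counted by [Ncount r (\- f)], the negative part by
    [Ncount r f]. *)
Lemma tropical_jensen (R : realType) (f : R -> R) (r : R) :
  piecewise_linear f -> 0 <= r ->
  Ncount r (\- f) - Ncount r f = jensen_mean f r.
Proof.
move=> fPL r0.
(* The representation holds on an open interval and is evaluated at [r] and [- r], hence the extra
   unit. *)
have [s us k0] := finite_kinks (r + 1) fPL.
have [x xr|a [b fE]] := piecewise_linear_repr (r := r + 1) fPL us.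
  by apply: k0; move: xr => /andP[]; lra.
have oN x : omega (\- f) x = - omega f x.
  by have [w kw] := fPL x; rewrite (omega_kink kw) (omega_kink (kinkN kw)) mulrN.
have o0 x : - r < x < r -> x \notin s -> omega f x = 0.
  move=> /andP[xr rx] xs; rewrite (omega_kink (w := 0)) ?mulr0//.
  by apply: k0 => //; apply/andP; lra.
rewrite (Ncount_sum r0 us o0) (Ncount_sum r0 us); last first.
  by move=> x xr xs; rewrite oN o0 ?oppr0.
rewrite /jensen_mean !fE; try by apply/andP; lra.
have -> : 2^-1 * (a * r + b + \sum_(p <- s) omega f p / 2 * `|r - p|
     + (a * - r + b + \sum_(p <- s) omega f p / 2 * `| - r - p|))
    - (a * 0 + b + \sum_(p <- s) omega f p / 2 * `|0 - p|)
  = \sum_(p <- s) omega f p / 2 * jensen_mean (fun x => `|x - p|) r.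
  have -> : \sum_(p <- s) omega f p / 2 * jensen_mean (fun x => `|x - p|) r
    = \sum_(p <- s) (2^-1 * (omega f p / 2 * `|r - p| + omega f p / 2 * `| - r - p|)
       + - (omega f p / 2 * `|0 - p|)).
    by apply: eq_bigr => p _; rewrite /jensen_mean; ring.
  by rewrite big_split/= sumrN -mulr_sumr big_split/=; field.
rewrite -mulrBr -sumrB mulr_sumr; apply: eq_bigr => p _.
rewrite jensen_mean_abs_sub// oN opprK.
have [op|op] := leP 0 (omega f p).
  by rewrite (max_l (x := 0) (y := - _)) ?oppr_le0//; field.
by rewrite (max_r (x := 0) (y := - _)) ?oppr_ge0 ?ltW//; field.
Qed.

(** * Convex functions *)

Definition convex_on_line (R : realType) (f : R -> R) : Prop :=
  forall x y t, 0 <= t <= 1 ->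
    f (t * x + (1 - t) * y) <= t * f x + (1 - t) * f y.

Lemma convex_on_lineD (R : realType) (f g : R -> R) :
  convex_on_line f -> convex_on_line g -> convex_on_line (fun x => f x + g x).
Proof.
move=> hf hg x y t t01; have := hf x y t t01; have := hg x y t t01; lra.
Qed.

Lemma convex_on_lineZ (R : realType) (k : R) (f : R -> R) :
  0 <= k -> convex_on_line f -> convex_on_line (fun x => k * f x).
Proof.
move=> k0 hf x y t t01.
have -> : t * (k * f x) + (1 - t) * (k * f y) = k * (t * f x + (1 - t) * f y).
  by ring.
by rewrite ler_wpM2l// hf.
Qed.

Lemma convex_on_line_affine (R : realType) (a b : R) :
  convex_on_line (fun x => a * x + b).
Proof. by move=> x y t _; rewrite le_eqVlt; apply/orP; left; apply/eqP; ring. Qed.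

Lemma convex_on_line_max (R : realType) (f g : R -> R) :
  convex_on_line f -> convex_on_line g ->
  convex_on_line (fun x => Num.max (f x) (g x)).
Proof.
move=> hf hg x y t /andP[t0 t1]; have t1' : 0 <= 1 - t by rewrite subr_ge0.
have t01 : 0 <= t <= 1 by rewrite t0.
rewrite ge_max; apply/andP; split.
  apply: (le_trans (hf x y t t01)).
  by apply: lerD; apply: ler_wpM2l => //; rewrite le_max lexx.
apply: (le_trans (hg x y t t01)).
by apply: lerD; apply: ler_wpM2l => //; rewrite le_max lexx orbT.
Qed.

Lemma convex_on_line_comp_affine (R : realType) (a b : R) (f : R -> R) :
  convex_on_line f -> convex_on_line (fun x => f (a * x + b)).
Proof.
move=> hf x y t t01.
have -> : a * (t * x + (1 - t) * y) + b = t * (a * x + b) + (1 - t) * (a * y + b).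
  by ring.
exact: hf.
Qed.

Lemma convex_on_line_shift (R : realType) (s : R) (f : R -> R) :
  convex_on_line f -> convex_on_line (fun x => f (x + s)).
Proof.
move=> /(convex_on_line_comp_affine 1 s); congr convex_on_line.
by apply/funext => x; rewrite mul1r.
Qed.

Lemma convex_on_line_opp (R : realType) (f : R -> R) :
  convex_on_line f -> convex_on_line (fun x => f (- x)).
Proof.
move=> /(convex_on_line_comp_affine (-1) 0); congr convex_on_line.
by apply/funext => x; rewrite mulN1r addr0.
Qed.

Lemma convex_on_line_abs_sub (R : realType) (p : R) :
  convex_on_line (fun x => `|x - p|).
Proof.
move=> x y t /andP[t0 t1].
have -> : t * x + (1 - t) * y - p = t * (x - p) + (1 - t) * (y - p) by ring.
apply: (le_trans (ler_normD _ _)).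
by rewrite !normrM (ger0_norm t0) (ger0_norm (x := 1 - t)) ?subr_ge0.
Qed.

Lemma convex_on_line_sum (R : realType) (I : Type) (s : seq I) (P : pred I)
    (g : I -> R -> R) : (forall i, P i -> convex_on_line (g i)) ->
  convex_on_line (fun x => \sum_(i <- s | P i) g i x).
Proof.
move=> hg x y t t01; rewrite !mulr_sumr -big_split/=.
by apply: ler_sum => i Pi; exact: hg.
Qed.

(** Without poles every coefficient of [|x - p|] in the finite representation is nonnegative. *)
Lemma tropical_entire_convex (R : realType) (f : R -> R) :
  tropical_entire f -> convex_on_line f.
Proof.
move=> [/tropical_meromorphic_piecewise_linear fPL ofp] x y t /andP[t0 t1].
pose r := `|x| + `|y| + 1.
have [s us k0] := finite_kinks r fPL.
have [z zr|a [b fE]] := piecewise_linear_repr (r := r) fPL us.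
  by apply: k0; move: zr => /andP[]; lra.
have nx := normr_ge0 x; have ny := normr_ge0 y.
have xr : - r < x < r by rewrite -ltr_norml /r; lra.
have yr : - r < y < r by rewrite -ltr_norml /r; lra.
have tr : - r < t * x + (1 - t) * y < r.
  rewrite -ltr_norml; apply: (le_lt_trans (ler_normD _ _)).
  rewrite !normrM (ger0_norm t0) (ger0_norm (x := 1 - t)) ?subr_ge0//.
  have : t * `|x| <= 1 * `|x| by exact: ler_wpM2r.
  have : (1 - t) * `|y| <= 1 * `|y| by apply: ler_wpM2r => //; lra.
  by rewrite /r; lra.
rewrite !fE//.
apply: (convex_on_lineD (f := fun x => a * x + b)
  (g := fun x => \sum_(p <- s) omega f p / 2 * `|x - p|)); last by rewrite t0.
  exact: convex_on_line_affine.
apply: convex_on_line_sum => p _; apply: convex_on_lineZ.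
  by rewrite divr_ge0// leNgt; apply/negP; exact: ofp.
exact: convex_on_line_abs_sub.
Qed.

(** Midpoint convexity at [x + d / 2] and [x - d / 2] cancels the linear part and leaves
    [w >= 0]. *)
Lemma convex_omega_ge0 (R : realType) (f : R -> R) (x : R) :
  piecewise_linear f -> convex_on_line f -> 0 <= omega f x.
Proof.
move=> fPL fc; have [w kw] := fPL x; rewrite (omega_kink kw).
have [a [d [d0 fE]]] := kw.
have h0 : 0 < d / 2 by lra.
have := fc (x + d / 2) (x - d / 2) (2^-1).
have -> : 2^-1 * (x + d / 2) + (1 - 2^-1) * (x - d / 2) = x by field.
have e1 : x + d / 2 - x = d / 2 by ring.
have e2 : x - d / 2 - x = - (d / 2) by ring.
rewrite (fE (x + d / 2)) ?(fE (x - d / 2)) ?e1 ?e2 ?normrN ?gtr0_norm//; [|lra|lra].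
move=> /(_ _)/wrap[]; first by apply/andP; lra.
move=> h; suff : 0 <= w * (d / 2) by rewrite pmulr_lge0//; lra.
lra.
Qed.

Lemma Ncount_convex (R : realType) (f : R -> R) (r : R) :
  piecewise_linear f -> convex_on_line f -> 0 <= r ->
  Ncount r (\- f) = jensen_mean f r.
Proof.
move=> fPL fc r0; rewrite -tropical_jensen//.
have [s us k0] := finite_kinks r fPL.
suff -> : Ncount r f = 0 by rewrite subr0.
rewrite (Ncount_sum r0 us) ?big1 ?mulr0// => [p _|x /andP[x1 x2] xs].
  by rewrite max_l ?mul0r// oppr_le0; exact: convex_omega_ge0.
rewrite (omega_kink (w := 0)) ?mulr0//; apply: k0 => //.
by rewrite !ltW.
Qed.

Lemma convex_increment (R : realType) (f : R -> R) (x y h : R) :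
  convex_on_line f -> x <= y -> 0 <= h -> f (x + h) - f x <= f (y + h) - f y.
Proof.
move=> fc xy h0.
have [L0|L0] := leP (y + h - x) 0.
  by have [-> ->] : y = x /\ h = 0 by lra.
have Ln : y + h - x != 0 by rewrite gt_eqF.
(* With weights [s] and [1 - s], both [y] and [x + h] are convex combinations of [x] and [y + h],
   with the roles exchanged; adding the two inequalities gives the claim. *)
set s := h / (y + h - x).
have s01 : 0 <= s <= 1.
  apply/andP; split; first by apply: divr_ge0; lra.
  by rewrite /s ler_pdivrMr//; lra.
have := fc (y + h) x s s01.
have := fc x (y + h) s s01.
have -> : s * x + (1 - s) * (y + h) = y by rewrite /s; field.
have -> : s * (y + h) + (1 - s) * x = x + h by rewrite /s; field.
lra.
Qed.

Lemma convex_jensen_mean (R : realType) (f : R -> R) :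
  convex_on_line f -> convex_on_line (jensen_mean f).
Proof.
move=> fc x y t t01.
have := fc x y t t01; have := @convex_on_line_opp _ _ fc x y t t01.
by rewrite /jensen_mean; lra.
Qed.

Lemma jensen_mean0 (R : realType) (f : R -> R) : jensen_mean f 0 = 0.
Proof. by rewrite /jensen_mean oppr0; field. Qed.

(** The mean is convex and even in [r], and [r] lies between [- t] and [t]. *)
Lemma jensen_mean_nondecreasing (R : realType) (f : R -> R) (r t : R) :
  convex_on_line f -> 0 <= r <= t -> jensen_mean f r <= jensen_mean f t.
Proof.
move=> fc /andP[r0 rt]; have [t0|t0] := leP t 0.
  by have -> : r = t by lra.
have tn : t != 0 by rewrite gt_eqF.
have s01 : 0 <= (r + t) / (2 * t) <= 1.
  apply/andP; split; first by apply: divr_ge0; lra.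
  by rewrite ler_pdivrMr; lra.
have := @convex_jensen_mean _ _ fc t (- t) _ s01.
have -> : (r + t) / (2 * t) * t + (1 - (r + t) / (2 * t)) * - t = r by field.
by rewrite /jensen_mean opprK; lra.
Qed.

Lemma jensen_mean_ge0 (R : realType) (f : R -> R) (r : R) :
  convex_on_line f -> 0 <= r -> 0 <= jensen_mean f r.
Proof.
by move=> fc r0; rewrite -(jensen_mean0 f) jensen_mean_nondecreasing// lexx.
Qed.

(** Twice the increment of the mean is the sum of the changes of [f] at [r] and at [- r]; the latter
    is at least [f (- H) - f 0], which bounds [f (r + H)]. Growing increments bound [f (r - H)],
    convexity interpolates, and the midpoint inequality turns the upper bound for [- h] into the
    lower one for [h]. *)
Lemma convex_translate_right (R : realType) (f : R -> R) (r h H : R) :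
  convex_on_line f -> 0 <= r -> `|h| <= H ->
  `|f (r + h) - f r| <= 2 * (jensen_mean f (r + H) - jensen_mean f r)
     + `|f 0 - f (- H)|.
Proof.
move=> fc r0 hH; have H0 : 0 <= H by exact: le_trans (normr_ge0 h) hH.
set B := 2 * _ + _.
have JB : 0 <= jensen_mean f (r + H) - jensen_mean f r.
  by rewrite subr_ge0 jensen_mean_nondecreasing// r0 lerDl.
have aB := ler_norm (f 0 - f (- H)); have aB' := ler_norm (- (f 0 - f (- H))).
rewrite normrN in aB'.
have up : f (r + H) - f r <= B.
  have := convex_increment fc (_ : - (r + H) <= - H) H0.
  move=> /(_ _)/wrap[]; first lra.
  have -> : - (r + H) + H = - r by ring.
  by rewrite addNr /B /jensen_mean; lra.
have down : f (r - H) - f r <= B.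
  have := convex_increment fc (_ : - H <= r - H) H0.
  move=> /(_ _)/wrap[]; first lra.
  by rewrite subrK addNr /B; lra.
have key k : `|k| <= H -> f (r + k) - f r <= B.
  move=> kH; have [H1|H1] := leP H 0.
    have -> : k = 0 by apply/eqP; rewrite -normr_le0; lra.
    by rewrite addr0 subrr /B; have := normr_ge0 (f 0 - f (- H)); lra.
  have Hn : H != 0 by rewrite gt_eqF.
  move: kH; rewrite ler_norml => /andP[k1 k2].
  have s01 : 0 <= (k + H) / (2 * H) <= 1.
    apply/andP; split; first by apply: divr_ge0; lra.
    by rewrite ler_pdivrMr; lra.
  have := fc (r + H) (r - H) _ s01.
  have -> : (k + H) / (2 * H) * (r + H) + (1 - (k + H) / (2 * H)) * (r - H) = r + k.
    by field.
  set s := (k + H) / (2 * H) in s01 *; move: s01 => /andP[s0 s1].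
  have : s * (f (r + H) - f r) <= s * B by exact: ler_wpM2l.
  have : (1 - s) * (f (r - H) - f r) <= (1 - s) * B by apply: ler_wpM2l => //; lra.
  lra.
rewrite ler_norml key// andbT.
have := key (- h); rewrite normrN => /(_ hH).
have := fc (r + h) (r - h) (2^-1).
have -> : 2^-1 * (r + h) + (1 - 2^-1) * (r - h) = r by field.
move=> /(_ _)/wrap[]; first by apply/andP; lra.
lra.
Qed.

(** At [- r] the estimate is applied to the reflected function, which has the same Jensen mean. *)
Lemma convex_translate (R : realType) (f : R -> R) (H : R) :
  convex_on_line f -> exists A, forall r h, 0 <= r -> `|h| <= H ->
    `|f (r + h) - f r| <= 2 * (jensen_mean f (r + H) - jensen_mean f r) + A /\
    `|f (- r + h) - f (- r)|
       <= 2 * (jensen_mean f (r + H) - jensen_mean f r) + A.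
Proof.
move=> fc; exists (`|f 0 - f (- H)| + `|f 0 - f H|) => r h r0 hH.
have n1 := normr_ge0 (f 0 - f (- H)); have n2 := normr_ge0 (f 0 - f H).
split.
  by apply: (le_trans (convex_translate_right fc r0 hH)); lra.
have hH' : `|- h| <= H by rewrite normrN.
have := convex_translate_right (convex_on_line_opp fc) r0 hH'.
rewrite opprD !opprK oppr0.
have J s : jensen_mean (fun x => f (- x)) s = jensen_mean f s.
  by rewrite /jensen_mean opprK oppr0 (addrC (f (- s))).
by rewrite !J => /le_trans; apply; lra.
Qed.

(** * Exceptional sets of zero upper density *)

Lemma limf_esup_pinfty_eq0 (R : realType) (g : R -> \bar R) :
  (forall r, (0 <= g r)%E) ->
  (forall e : R, 0 < e -> \forall r \near +oo, (g r <= e%:E)%E) ->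
  limf_esup g (pinfty_nbhs R) = 0%E.
Proof.
move=> g0 gle; apply/eqP; rewrite eq_le; apply/andP; split; last first.
  apply: limf_esup_ge0 => //; exact: filter_not_empty.
apply/lee_addgt0Pr => e e0; rewrite add0e.
apply: (@le_trans _ _ (ereal_sup [set g x | x in [set r | (g r <= e%:E)%E]])).
  apply: ereal_inf_lbound; exists [set r | (g r <= e%:E)%E] => //.
  exact: gle.
by apply: ge_ereal_sup => _ [r /= gr <-].
Qed.

Lemma limf_esup_pinfty_le (R : realType) (g : R -> R) (e : R) :
  limf_esup (fun r => (g r)%:E) (pinfty_nbhs R) = 0%E -> 0 < e ->
  \forall r \near +oo, g r <= e.
Proof.
move=> g0 e0.
have : (limf_esup (fun r => (g r)%:E) (pinfty_nbhs R) < e%:E)%E.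
  by rewrite g0 lte_fin.
move=> /ereal_inf_lt[_ [V FV <-] Ve].
apply: filterS FV => r Vr; rewrite -lee_fin; apply: le_trans (ltW Ve).
by apply: ereal_sup_ubound; exists r.
Qed.

Section growth_blocks.
Variables (R : realType) (U : R -> R) (H : R).
Hypothesis H_gt0 : 0 < H.
Hypothesis U_ge1 : forall r, 0 <= r -> 1 <= U r.
Hypothesis U_nondecreasing : forall r t, 0 <= r <= t -> U r <= U t.
Hypothesis U_subexp :
  forall e : R, 0 < e -> \forall r \near +oo, ln (U r) <= e * r.

(** Monotonicity of [U] lets its values at the block endpoints control it everywhere. *)
Let u (m : nat) : R := ln (U (m%:R * H)).

Let mH_ge0 (m : nat) : 0 <= m%:R * H.
Proof. by rewrite mulr_ge0// ltW. Qed.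

Let u_ge0 m : 0 <= u m.
Proof. by rewrite ln_ge0// U_ge1. Qed.

Let u_le m k : (m <= k)%N -> u m <= u k.
Proof.
move=> mk; rewrite ler_ln ?posrE ?(lt_le_trans ltr01) ?U_ge1//.
by rewrite U_nondecreasing// mH_ge0/= ler_wpM2r ?ler_nat// ltW.
Qed.

(* [theta] bounds the density of the telescoping sum below; its square-rooted tail
   supremum [eps] is a threshold that decreases to 0 but stays above
   [sqrt theta]. *)
Let theta (m : nat) : R := (2 * u m.+1 + 1) / m.+1%:R.

Let theta_gt0 m : 0 < theta m.
Proof. by rewrite divr_gt0// ltr_wpDl// mulr_ge0. Qed.

Let theta_cvg0 : theta @ \oo --> 0.
Proof.
apply/cvgrPdist_le => /= e e0.
(* With this constant [2 * u m.+1] is at most half of [e * m.+1]; the other half absorbs the 1. *)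
have e4 : 0 < e / (4 * H) by rewrite divr_gt0// mulr_gt0.
have [A [_ hA]] := U_subexp e4.
near=> m; rewrite sub0r normrN gtr0_norm// /theta ler_pdivrMr//.
have h1 : u m.+1 <= e / (4 * H) * (m.+1%:R * H).
  apply: hA; rewrite -ltr_pdivrMr//.
  near: m; exists (Num.truncn `|A / H|).+1 => // m /= hm.
  apply: (le_lt_trans (ler_norm _)).
  apply: (lt_le_trans (truncnS_gt _)); rewrite ler_nat.
  by rewrite ltnW.
have h2 : 1 <= e / 2 * m.+1%:R.
  rewrite mulrC -ler_pdivrMr ?divr_gt0// mul1r.
  near: m; exists (Num.truncn (e / 2)^-1) => // m /= hm.
  by rewrite ltW// (lt_le_trans (truncnS_gt _))// ler_nat ltnS.
have -> : e * m.+1%:R = 2 * (e / (4 * H) * (m.+1%:R * H)) + e / 2 * m.+1%:R.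
  by field; rewrite gt_eqF.
by lra.
Unshelve. all: by end_near. Qed.

Let eps (m : nat) : R := Num.sqrt (sups theta m).

Let theta_has_ubound : has_ubound (range theta).
Proof.
apply/bounded_fun_has_ubound/cvg_seq_bounded/cvg_ex.
by exists 0.
Qed.

Let theta_le_sups m : theta m <= sups theta m.
Proof.
apply: ub_le_sup; last by exists m => /=.
exact: has_ubound_sdrop.
Qed.

Let eps_nonincreasing m k : (m <= k)%N -> eps k <= eps m.
Proof. by move=> mk; apply: ler_wsqrtr; exact: nonincreasing_sups. Qed.

Let eps_gt0 m : 0 < eps m.
Proof. by rewrite sqrtr_gt0 (lt_le_trans (theta_gt0 m)). Qed.

Let theta_le_eps m : theta m <= eps m * eps m.
Proof.
by rewrite -expr2 sqr_sqrtr// (le_trans _ (theta_le_sups m))// ltW.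
Qed.

Let eps_small (e : R) : 0 < e -> exists M, forall m, (M <= m)%N -> eps m <= e.
Proof.
move=> e0; have /cvgrPdist_lt/(_ (e ^+ 2)) := cvg_sups theta_cvg0.
move=> /(_ (exprn_gt0 _ e0))[M _ hM]; exists M => m Mm.
rewrite -[e]gtr0_norm// -sqrtr_sqr; apply: ler_wsqrtr.
by have := hM m Mm; rewrite sub0r normrN => /ltW; apply: le_trans; exact: ler_norm.
Qed.

(* On a block [[i H, (i + 1) H[] that is not bad, [ln U (r + H) - ln U r <= eps i].
   The sum of [u i.+2 - u i] telescopes to [O(u M.+1) = o(M)], so there are few
   bad blocks. *)
Let bad (i : nat) : bool := eps i < u i.+2 - u i.

Let bad_count M : \sum_(i < M) (bad i)%:R * eps M <= eps M * eps M * M.+1%:R.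
Proof.
(* The thresholds decrease, so a bad block [i < M] has an increment above [eps i >= eps M]; all
   other increments are nonnegative. *)
have le1 : \sum_(i < M) (bad i)%:R * eps M <= \sum_(i < M) (u i.+2 - u i).
  apply: ler_sum => i _; case: (boolP (bad i)) => bi; last first.
    by rewrite mul0r subr_ge0 u_le// -addn2 leq_addr.
  by rewrite mul1r (le_trans _ (ltW bi))// eps_nonincreasing// ltnW.
have tel : \sum_(i < M) (u i.+2 - u i) = u M.+1 + u M - u 1 - u 0.
  elim: (M) => [|k IH]; first by rewrite big_ord0; ring.
  by rewrite big_ord_recr/= IH; ring.
apply: (le_trans le1); rewrite tel.
have := theta_le_eps M; rewrite /theta ler_pdivrMr// => /(le_trans _); apply.
have := u_le (leqnSn M); have := u_ge0 1; have := u_ge0 0; lra.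
Qed.

Let bad_count_le M : \sum_(i < M) (bad i)%:R <= eps M * M.+1%:R.
Proof.
have := bad_count M; rewrite -mulr_suml -mulrA (mulrC (eps M) (_ * _)).
(* One factor [eps M] cancels; the [+ 1] in [theta] is what makes it positive. *)
by rewrite ler_pM2r// eps_gt0.
Qed.

Let E : set R := \bigcup_(i in [set i | bad i]) `[i%:R * H, i.+1%:R * H[%classic.

Let block (r : R) : nat := Num.truncn (r / H).

Let blockP r : 0 <= r -> (block r)%:R * H <= r < (block r).+1%:R * H.
Proof.
move=> r0; have : 0 <= r / H by rewrite divr_ge0// ltW.
by move=> /truncn_itv; rewrite ler_pdivlMr// ltr_pdivrMr.
Qed.

Let measurable_E : measurable E.
Proof. by apply: bigcup_measurable => i _; exact: measurable_itv. Qed.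

Let measure_E r : 1 <= r ->
  (lebesgue_measure (E `&` `[1%R, r])
    <= (H * (eps (block r).+1 * (block r).+2%:R))%:E)%E.
Proof.
move=> r1; have r0 : 0 <= r by exact: le_trans r1.
(* Up to [r] the set [E] is covered by the bad ones among the first [(block r).+1] blocks, each of
   length [H]. *)
pose B i := if bad i then `[i%:R * H, i.+1%:R * H[%classic else set0 : set R.
have mB i : measurable (B i).
  by rewrite /B; case: ifP => _; [exact: measurable_itv|exact: measurable0].
apply: (@le_trans _ _ (\sum_(i < (block r).+1) lebesgue_measure (B i))%E).
  apply: content_subadditive => [k _||]; first exact: mB.
    exact: measurableI.
  move=> x [[i /= bi]]; rewrite !in_itv/= => /andP[ix xi] /andP[_ xr].
  rewrite -bigcup_mkord; exists i => /=; last by rewrite /B bi/= in_itv/= ix.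
  have /andP[_ rb] := blockP r0.
  have : i%:R * H < (block r).+1%:R * H by rewrite (le_lt_trans ix)// (le_lt_trans xr).
  by rewrite ltr_pM2r// ltr_nat.
have -> : (\sum_(i < (block r).+1) lebesgue_measure (B i)
    = (H * \sum_(i < (block r).+1) (bad i)%:R)%:E)%E.
  rewrite mulr_sumr -sumEFin; apply: eq_bigr => i _.
  rewrite /B; case: ifP => _; last by rewrite measure0 mulr0.
  rewrite lebesgue_measure_itv/= lte_fin ltr_pM2r// ltr_nat ltnSn -EFinD.
  by rewrite -mulrBl -natrB ?subSnn// mulr1 mul1r.
by rewrite lee_fin ler_wpM2l ?bad_count_le// ltW.
Qed.

Lemma growth_outside_blocks : exists E : set R, zero_upper_density E /\
  forall e : R, 0 < e ->
    \forall r \near pinfty_outside E, U (r + H) - U r <= e * U r.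
Proof.
exists E; split.
  split; first exact: measurable_E.
  have int1 (A : set R) : measurable A ->
      (\int[@lebesgue_measure R]_(t in A) 1 = lebesgue_measure A)%E.
    by move=> mA; rewrite integral_cst// mul1e.
  have mA r : measurable (E `&` `[1%R, r]) by exact: measurableI.
  apply: limf_esup_pinfty_eq0 => [r|e e0].
    rewrite int1//; have [r1|r1] := leP 1 r.
      by rewrite mule_ge0// lee_fin invr_ge0 (le_trans ler01).
    suff -> : E `&` `[1, r]%classic = set0 by rewrite measure0 mule0.
    apply/seteqP; split=> // x [_ /=]; rewrite in_itv/= => /andP[x1 xr].
    by have := lt_le_trans r1 (le_trans x1 xr); rewrite ltxx.
  have e2 : 0 < e / 2 by lra.
  have [M hM] := eps_small e2.
  near=> r.
  have r1 : 1 <= r by near: r; apply: nbhs_pinfty_ge; exact: num_real.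
  have r0 : 0 < r by exact: lt_le_trans r1.
  have r2H : 2 * H <= r by near: r; apply: nbhs_pinfty_ge; exact: num_real.
  have rM : M%:R * H <= r by near: r; apply: nbhs_pinfty_ge; exact: num_real.
  rewrite int1//.
  apply: (@le_trans _ _ (r^-1%:E * (H * (eps (block r).+1 * (block r).+2%:R))%:E)%E).
    by rewrite lee_wpmul2l ?measure_E// lee_fin invr_ge0 ltW.
  rewrite -EFinM lee_fin mulrC ler_pdivrMr//.
  have /andP[br rb] := blockP (ltW r0).
  have Mb : (M <= (block r).+1)%N.
    have : M%:R * H < (block r).+1%:R * H by exact: le_lt_trans rb.
    by rewrite ltr_pM2r// ltr_nat => /ltnW.
  have -> : H * (eps (block r).+1 * (block r).+2%:R)
      = eps (block r).+1 * ((block r)%:R * H + 2 * H).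
    by rewrite -addn2 natrD; ring.
  (* The left end of the block and [2 * H] are both at most [r], hence the choice of [e / 2]. *)
  apply: (@le_trans _ _ (e / 2 * (r + r))); last by lra.
  apply: ler_pM; [exact: ltW|by rewrite addr_ge0// mulr_ge0 ?ltW| exact: hM|].
  exact: lerD.
move=> e e0.
have l0 : 0 < ln (1 + e) by rewrite ln_gt0// ltrDl.
(* On a good block [ln U] grows by at most [eps], so the threshold [ln (1 + e)] becomes the factor
   [1 + e]. *)
have [M hM] := eps_small l0.
suff : \forall r \near +oo, (~` E) r -> U (r + H) - U r <= e * U r by [].
near=> r => Er.
have r0 : 0 <= r by near: r; apply: nbhs_pinfty_ge; exact: num_real.
have rM : M%:R * H <= r by near: r; apply: nbhs_pinfty_ge; exact: num_real.
have /andP[br rb] := blockP r0.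
have Mb : (M <= block r)%N.
  have : M%:R * H < (block r).+1%:R * H by exact: le_lt_trans rb.
  by rewrite ltr_pM2r// ltr_nat ltnS.
have nb : ~~ bad (block r).
  by apply/negP => b; apply: Er; exists (block r) => //=; rewrite in_itv/= br.
have d : u (block r).+2 <= ln (1 + e) + u (block r).
  by move: nb; rewrite /bad -leNgt => nb; have := hM _ Mb; lra.
have Upos m : 0 < U (m%:R * H) by rewrite (lt_le_trans ltr01)// U_ge1.
have : U ((block r).+2%:R * H) <= (1 + e) * U ((block r)%:R * H).
  have e1 : 0 < 1 + e by lra.
  rewrite -ler_ln ?posrE ?mulr_gt0// lnM ?posrE//.
(* [r + H] lies in the block after that of [r]; this is why [bad] compares [u i.+2] with [u i]. *)
have h1 : U (r + H) <= U ((block r).+2%:R * H).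
  apply: U_nondecreasing; apply/andP; split; first by rewrite addr_ge0// ltW.
  by rewrite -(addn1 (block r).+1) natrD mulrDl mul1r lerD2r ltW.
have h2 : (1 + e) * U ((block r)%:R * H) <= (1 + e) * U r.
  by rewrite ler_wpM2l ?U_nondecreasing ?mH_ge0 ?br//; lra.
lra.
Unshelve. all: by end_near. Qed.

End growth_blocks.

(** * Tropical linear forms and the Casoratian *)

(** The starting value varies with [x] too, since the reals have no neutral element for the maximum;
    the norm, the forms and the Casoratian all have this shape. *)
Lemma bigmax_closed (R : realType) (Q : (R -> R) -> Prop) (I : Type)
    (s : seq I) (P : pred I) (f : R -> R) (g : I -> R -> R) :
  (forall h k, Q h -> Q k -> Q (fun x => Num.max (h x) (k x))) ->
  Q f -> (forall i, P i -> Q (g i)) ->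
  Q (fun x => \big[Num.max/f x]_(i <- s | P i) g i x).
Proof.
move=> Qmax Qf Qg; elim: s => [|i s IH].
  have -> // : (fun x => \big[Num.max/f x]_(i <- [::] | P i) g i x) = f.
  by apply/funext => x; rewrite big_nil.
have -> : (fun x => \big[Num.max/f x]_(j <- i :: s | P j) g j x)
    = if P i then fun x => Num.max (g i x) (\big[Num.max/f x]_(j <- s | P j) g j x)
      else fun x => \big[Num.max/f x]_(j <- s | P j) g j x.
  by case: ifP => Pi; apply/funext => x; rewrite big_cons Pi.
by case: ifP => [/Qg Qi|//]; exact: Qmax.
Qed.

Definition convex_piecewise_linear (R : realType) (f : R -> R) : Prop :=
  piecewise_linear f /\ convex_on_line f.

Lemma convex_piecewise_linear_max (R : realType) (f g : R -> R) :
  convex_piecewise_linear f -> convex_piecewise_linear g ->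
  convex_piecewise_linear (fun x => Num.max (f x) (g x)).
Proof.
move=> [fPL fc] [gPL gc].
by split; [exact: piecewise_linear_max|exact: convex_on_line_max].
Qed.

Lemma convex_piecewise_linear_sum (R : realType) (I : Type) (s : seq I)
    (P : pred I) (g : I -> R -> R) :
  (forall i, P i -> convex_piecewise_linear (g i)) ->
  convex_piecewise_linear (fun x => \sum_(i <- s | P i) g i x).
Proof.
by move=> hg; split; [apply: piecewise_linear_sum|apply: convex_on_line_sum];
  move=> i /hg[].
Qed.

Lemma convex_piecewise_linear_shift (R : realType) (s : R) (f : R -> R) :
  convex_piecewise_linear f -> convex_piecewise_linear (fun x => f (x + s)).
Proof.
by move=> [fPL fc]; split; [exact: piecewise_linear_shift|exact: convex_on_line_shift].
Qed.

Lemma convex_piecewise_linear_casoratian (R : realType) (n : nat) (c : R)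
    (g : 'I_n.+1 -> R -> R) :
  (forall k, convex_piecewise_linear (g k)) ->
  convex_piecewise_linear (casoratian c g).
Proof.
move=> hg; apply: bigmax_closed => [|| s _]; first exact: convex_piecewise_linear_max.
  by apply: convex_piecewise_linear_sum => k _; exact: convex_piecewise_linear_shift.
by apply: convex_piecewise_linear_sum => k _; exact: convex_piecewise_linear_shift.
Qed.

Lemma casoratian_close (R : realType) (n : nat) (c : R)
    (g : 'I_n.+1 -> R -> R) (x B : R) :
  (forall k (m : nat), (m <= n)%N -> `|g k (x + m%:R * c) - g k x| <= B) ->
  `|casoratian c g x - \sum_k g k x| <= n.+1%:R * B.
Proof.
move=> hB.
(* Arbitrary shifts [s k <= n] cover the permutations as well as the starting value, whose shifts
   are the [k] themselves. *)
have key (s : 'I_n.+1 -> nat) : (forall k, (s k <= n)%N) ->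
    `|\sum_k g k (x + (s k)%:R * c) - \sum_k g k x| <= n.+1%:R * B.
  move=> hs; rewrite -sumrB; apply: (le_trans (ler_norm_sum _ _ _)).
  apply: (@le_trans _ _ (\sum_(k < n.+1) B)); first by apply: ler_sum => k _; exact: hB.
  by rewrite sumr_const card_ord mulr_natl.
have ks (s : 'S_n.+1) := key (fun k => s k) (fun k => ltn_ord (s k)).
have k1 := key (fun k => k) (fun k => ltn_ord k).
rewrite /casoratian ler_norml; apply/andP; split.
  have := ks 1%g; rewrite ler_norml => /andP[h _]; apply: (le_trans h).
  by rewrite lerD2r; apply: (bigmax_sup (1%g : 'S_n.+1)).
rewrite lerBlDr; apply: bigmax_le => [|s _].
  by have := k1; rewrite ler_norml lerBlDr => /andP[].
by have := ks s; rewrite ler_norml lerBlDr => /andP[].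
Qed.

Lemma enum_val_increasing (n : nat) (A : {set 'I_n.+1}) (i j : 'I_#|A|) :
  (i < j)%N -> (enum_val i < enum_val j)%N.
Proof.
have tr : transitive (relpre (@nat_of_ord n.+1) ltn).
  by move=> y x z; exact: ltn_trans.
have srt : sorted (relpre (@nat_of_ord n.+1) ltn) (enum A).
  rewrite /enum_mem sorted_filter//.
  by rewrite -enumT -sorted_map val_enum_ord iota_ltn_sorted.
move=> ij; rewrite !(enum_val_nth ord0).
by apply: (sorted_ltn_nth tr) => //; rewrite inE -cardE.
Qed.

Lemma bigmin_nat_le (N : nat) (s : seq nat) (P : pred nat) (i : nat) :
  i \in s -> P i -> (\big[minn/N]_(j <- s | P j) j <= i)%N.
Proof.
move=> + Pi; elim: s => // j s IH; rewrite inE => /predU1P[<-|/IH h].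
  by rewrite big_cons Pi geq_minl.
rewrite big_cons; case: ifP => // _.
exact: leq_trans (geq_minr _ _) h.
Qed.

(** * Real coefficients of a tropical linear form, and completeness *)

Section tform_comp.
Variables (R : realType) (n : nat) (a : tcoord R n) (fr : 'I_n.+1 -> R -> R).

Let term (k : 'I_n.+1) (x : R) : R := fine (val a k) + fr k x.

Lemma tcoord_neq_pinfty (k : 'I_n.+1) : val a k != +oo%E.
Proof. by have /andP[/forallP] := valP a. Qed.

Lemma tcoord_term (k : 'I_n.+1) (x : R) : val a k \is a fin_num ->
  (val a k + (fr k x)%:E)%E = (term k x)%:E.
Proof. by move=> ak; rewrite /term EFinD fineK. Qed.

Lemma tcoord_real : exists k, val a k \is a fin_num.
Proof.
have /andP[_ /existsP[k ak]] := valP a.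
by exists k; rewrite fin_numE ak tcoord_neq_pinfty.
Qed.

Lemma tcoord_nreal (k : 'I_n.+1) : val a k \isn't a fin_num -> val a k = -oo%E.
Proof. by rewrite fin_numE (tcoord_neq_pinfty k) andbT negbK => /eqP. Qed.

Lemma tform_compE (k0 : 'I_n.+1) (x : R) : val a k0 \is a fin_num ->
  tform a (tcoord_of (fun k => fr k x))
    = (\big[Num.max/term k0 x]_(k | val a k \is a fin_num) term k x)%:E.
Proof.
move=> ak0; rewrite /tform -EFin_bigmax; apply/eqP; rewrite eq_le; apply/andP; split.
  apply: bigmax_le => [|k _]; first exact: leNye.
  rewrite ffunE; have [ak|ak] := boolP (val a k \is a fin_num).
    by rewrite (tcoord_term _ ak); apply: (bigmax_sup k).
  by rewrite (tcoord_nreal ak) addNye; exact: leNye.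
have le k : val a k \is a fin_num -> ((term k x)%:E <=
    \big[maxe/-oo]_(k < n.+1) (val a k + val (tcoord_of (fun k => fr k x)) k))%E.
  by move=> ak; apply: (bigmax_sup k) => //; rewrite ffunE tcoord_term.
by apply: bigmax_le => [|k]; exact: le.
Qed.

Lemma tform_comp_EFin (x : R) :
  tform a (tcoord_of (fun k => fr k x)) = (tform_comp a fr x)%:E.
Proof. by have [k0 ak0] := tcoord_real; rewrite /tform_comp (tform_compE _ ak0). Qed.

Lemma tform_comp_closed (Q : (R -> R) -> Prop) :
  (forall h k, Q h -> Q k -> Q (fun x => Num.max (h x) (k x))) ->
  (forall k, Q (term k)) -> Q (tform_comp a fr).
Proof.
move=> Qmax Qt; have [k0 ak0] := tcoord_real.
suff -> : tform_comp a fr = fun x =>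
    \big[Num.max/term k0 x]_(k | val a k \is a fin_num) term k x.
  exact: bigmax_closed.
by apply/funext => x; rewrite /tform_comp (tform_compE _ ak0).
Qed.

Lemma tform_comp_le_tnorm (x : R) :
  tform_comp a fr x <= tnorm fr x + \sum_k `|fine (val a k)|.
Proof.
have [k0 ak0] := tcoord_real; rewrite /tform_comp (tform_compE _ ak0)/=.
have le k : term k x <= tnorm fr x + \sum_k `|fine (val a k)|.
  rewrite addrC lerD//; last exact: le_bigmax.
  rewrite (bigD1 k)//= (le_trans (ler_norm _))// lerDl.
  by apply: sumr_ge0.
by apply: bigmax_le => [|k _]; exact: le.
Qed.

(** With all coefficients real each [fr k] occurs in the maximum, up to its own coefficient. *)
Lemma tnorm_le_tform_comp (x : R) : (forall k, val a k \is a fin_num) ->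
  tnorm fr x <= tform_comp a fr x + \sum_k `|fine (val a k)|.
Proof.
move=> afin.
have le k : fr k x <= tform_comp a fr x + \sum_k `|fine (val a k)|.
  apply: (@le_trans _ _ (term k x + `|fine (val a k)|)).
    by have := ler_norm (- fine (val a k)); rewrite normrN /term; lra.
  apply: lerD; last by rewrite (bigD1 k)//= lerDl sumr_ge0.
  by rewrite /tform_comp (tform_compE _ (afin k)); apply: (bigmax_sup k).
by apply: bigmax_le => [|k _]; exact: le.
Qed.

(** If some coefficient were [-oo], the at most [n] real ones would already express the form, and
    [ell] would be at most [n]. *)
Lemma tcomplete_real : tcomplete fr (tform_comp a fr) ->
  forall k, val a k \is a fin_num.
Proof.
move=> /eqP ell_eq k; apply: contraT => ak.
pose A := [set k | val a k \is a fin_num]%SET.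
have [k0 ak0] := tcoord_real; have Ak0 : k0 \in A by rewrite inE.
have A_gt0 : (0 < #|A|)%N by apply/card_gt0P; exists k0.
have A_le : (#|A| <= n)%N.
  have : A \proper [set: 'I_n.+1]%SET.
    by apply/properP; split; [exact: finset.subsetT|exists k; rewrite ?inE].
  by move=> /proper_card; rewrite cardsT card_ord.
suff comb : combination_of_length fr (tform_comp a fr) #|A|.
  have : (ell fr (tform_comp a fr) <= #|A|)%N.
    apply: bigmin_nat_le; last exact/asboolP.
    by rewrite mem_index_iota A_gt0 ltnS leqW.
  by rewrite ell_eq => /leq_trans/(_ A_le); rewrite ltnn.
exists (fun i => enum_val i), (fun i => fine (val a (enum_val i))).
split=> [i j|x]; first exact: enum_val_increasing.
rewrite -tform_comp_EFin (tform_compE _ ak0) -EFin_bigmax.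
have term_le l : val a l \is a fin_num -> ((term l x)%:E <=
    \big[maxe/-oo]_(i < #|A|) (fine (val a (enum_val i)) + fr (enum_val i) x)%:E)%E.
  move=> al; have Al : l \in A by rewrite inE.
  by apply: (bigmax_sup (enum_rank_in Al l)) => //; rewrite enum_rankK_in.
apply/eqP; rewrite eq_le; apply/andP; split.
  by apply: bigmax_le => [|l]; exact: term_le.
apply: bigmax_le => [|i _]; first exact: leNye.
apply: (bigmax_sup (enum_val i)) => //.
by have := enum_valP i; rewrite inE.
Qed.

End tform_comp.

(** * Growth of the characteristic *)

Lemma convex_bounded_above_cst (R : realType) (h : R -> R) (B : R) :
  convex_on_line h -> (forall x, h x <= B) -> forall x y, h x = h y.
Proof.
move=> hc hB.
suff le x y : h y <= h x by move=> x y; apply/eqP; rewrite eq_le !le.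
rewrite leNgt; apply/negP => xy.
have By := hB y.
have B0 : 0 < B - h x by lra.
have B0n : B - h x != 0 by rewrite gt_eqF.
have yx0 : h y - h x != 0 by rewrite gt_eqF// subr_gt0.
(* On the ray from [x] through [y], the value at [x + (y - x) / t] would be at least
   [h x + 2 (B - h x)], which exceeds [B]. *)
set t := (h y - h x) / (2 * (B - h x)).
have t0 : 0 < t by rewrite divr_gt0// ?mulr_gt0// subr_gt0.
have t1 : t <= 1 by rewrite ler_pdivrMr ?mulr_gt0//; lra.
have t01 : 0 <= t <= 1 by rewrite ltW.
have tn : t != 0 by rewrite gt_eqF.
have := hc (x + (y - x) / t) x t t01.
have -> : t * (x + (y - x) / t) + (1 - t) * x = y by field.
have : t * h (x + (y - x) / t) <= t * B by rewrite ler_wpM2l// ltW.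
have : t * (B - h x) = (h y - h x) / 2.
  by rewrite /t; field.
lra.
Qed.

Lemma convex_piecewise_linear_tnorm (R : realType) (n : nat)
    (fr : 'I_n.+1 -> R -> R) :
  (forall k, convex_piecewise_linear (fr k)) ->
  convex_piecewise_linear (tnorm fr).
Proof.
by move=> hfr; apply: bigmax_closed => //; exact: convex_piecewise_linear_max.
Qed.

(* If [T] vanished, [g = ||f||] would satisfy [g (- x) = 2 g 0 - g x], so each
   [f_k - g] would be convex and nonpositive, hence constant. *)
Lemma nondegenerate_Tchar_gt0 (R : realType) (n : nat) (f : R -> TP R n)
    (fr : 'I_n.+1 -> R -> R) : (0 < n)%N ->
  (forall k, convex_piecewise_linear (fr k)) ->
  (forall x, f x = tpoint (tcoord_of (fun j => fr j x))) ->
  linearly_nondegenerate f ->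
  exists2 r, 0 < r & 0 < Tchar fr r.
Proof.
move=> n0 frc fE nd; apply: contrapT => noT.
pose g := tnorm fr.
have [_ gc] := convex_piecewise_linear_tnorm frc.
have T0 r : 0 <= r -> g r + g (- r) = 2 * g 0.
  rewrite le_eqVlt => /predU1P[<-|r0]; first by rewrite oppr0; ring.
  have := jensen_mean_ge0 gc (ltW r0).
  have : ~~ (0 < Tchar fr r) by apply/negP => Tr; apply: noT; exists r.
  by rewrite -leNgt /Tchar /jensen_mean -/g; lra.
have gN x : g (- x) = 2 * g 0 - g x.
  have [/T0|/ltW] := leP 0 x; first lra.
  by rewrite -oppr_ge0 => /T0; rewrite opprK; lra.
(* Written with [g (- x)] in place of [- g x], which displays it as a sum of convex functions. *)
pose h k x := fr k x + (g (- x) + - (2 * g 0)).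
have hE k x : h k x = fr k x - g x by rewrite /h gN; ring.
have h_cst k x : h k x = h k 0.
  apply: (@convex_bounded_above_cst _ _ 0) => [|y].
    apply: convex_on_lineD; first exact: (frc k).2.
    apply: convex_on_lineD; first exact: convex_on_line_opp.
    by move=> y z t _; lra.
  by rewrite hE subr_le0; exact: le_bigmax.
have termE k x : - h k 0 + fr k x = g x.
  by rewrite -(h_cst k x) hE; ring.
(* With these coefficients all [n + 1] monomials equal [g x] at every [x], so the whole curve lies
   in one hyperplane; [n > 0] supplies two distinct monomials. *)
pose d := tcoord_of (fun k => - h k 0).
apply: (nd d) => _ [x _ <-].
rewrite fE; apply/thyperplaneP; set p := tcoord_of _.
have tE k : (val d k + val p k)%E = (g x)%:E.
  by rewrite !ffunE -EFinD termE.
have formE : tform d p = (g x)%:E.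
  apply/eqP; rewrite eq_le; apply/andP; split.
    by apply: bigmax_le => [|k _]; [exact: leNye|rewrite tE].
  by apply: (bigmax_sup ord0) => //; rewrite tE.
exists ord0, ord_max; split; rewrite ?tE ?formE//.
by rewrite -val_eqE/= neq_ltn n0.
Qed.

(** The mean is convex and vanishes at 0, so beyond [r0] it lies above the line through the origin
    with slope [jensen_mean g r0 / r0]. *)
Lemma convex_jensen_mean_pinfty (R : realType) (g : R -> R) (r0 A : R) :
  convex_on_line g -> 0 < r0 -> 0 < jensen_mean g r0 ->
  \forall r \near +oo, A <= jensen_mean g r.
Proof.
move=> gc r00 J0; near=> r.
have rr0 : r0 <= r by near: r; apply: nbhs_pinfty_ge; exact: num_real.
have rA : r0 * A / jensen_mean g r0 <= r.
  by near: r; apply: nbhs_pinfty_ge; exact: num_real.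
have r_gt0 : 0 < r by exact: lt_le_trans rr0.
have t01 : 0 <= r0 / r <= 1.
  apply/andP; split; first by apply: divr_ge0; exact: ltW.
  by rewrite ler_pdivrMr// mul1r.
have := @convex_jensen_mean _ _ gc r 0 _ t01.
rewrite mulr0 addr0 jensen_mean0 mulr0 addr0 divfK ?gt_eqF//.
rewrite mulrAC ler_pdivlMr// => h.
move: rA; rewrite ler_pdivrMr// mulrC => rA.
by rewrite -(ler_pM2l r00) mulrC (le_trans rA)// mulrC.
Unshelve. all: by end_near. Qed.

(** * Comparison of Jensen means and the Casoratian defect *)

Lemma jensen_mean_le (R : realType) (f g : R -> R) (s : R) :
  (forall x, f x <= g x + s) ->
  exists C, forall r, jensen_mean f r <= jensen_mean g r + C.
Proof.
move=> fg; exists (s + g 0 - f 0) => r.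
by have := fg r; have := fg (- r); rewrite /jensen_mean; lra.
Qed.

Lemma near_pinfty_outside (R : realType) (E : set R) (P : R -> Prop) :
  (\forall r \near +oo, P r) -> \forall r \near pinfty_outside E, P r.
Proof. exact: filterS. Qed.

Lemma jensen_mean_sum (R : realType) (I : Type) (s : seq I) (P : pred I)
    (g : I -> R -> R) (r : R) :
  jensen_mean (fun x => \sum_(i <- s | P i) g i x) r
    = \sum_(i <- s | P i) jensen_mean (g i) r.
Proof. by rewrite /jensen_mean -big_split/= mulr_sumr -sumrB. Qed.

Lemma jensen_meanB (R : realType) (f g : R -> R) (r : R) :
  jensen_mean (fun x => f x - g x) r = jensen_mean f r - jensen_mean g r.
Proof. by rewrite /jensen_mean; ring. Qed.

Lemma jensen_mean_dist (R : realType) (f g : R -> R) (r B : R) :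
  `|f r - g r| <= B -> `|f (- r) - g (- r)| <= B ->
  `|jensen_mean f r - jensen_mean g r| <= B + `|f 0 - g 0|.
Proof.
rewrite -jensen_meanB /jensen_mean => h1 h2.
apply: (le_trans (ler_normB _ _)); rewrite lerD2r.
rewrite normrM (ger0_norm (x := 2^-1)) ?invr_ge0//.
have := ler_normD (f r - g r) (f (- r) - g (- r)); lra.
Qed.

(** One function [U] dominates the increments of all the means, so one exceptional set serves every
    [k]; since [U] is eventually at most a multiple of [T], errors [o(U)] are [o(T)]. *)
Lemma casoratian_defect (R : realType) (n : nat) (c : R)
    (g : 'I_n.+1 -> R -> R) (T : R -> R) :
  (forall k, convex_piecewise_linear (g k)) ->
  (forall k, exists C, forall r, jensen_mean (g k) r <= T r + C) ->
  (forall r, 0 <= r -> 0 <= T r) ->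
  (forall r t, 0 <= r <= t -> T r <= T t) ->
  (forall A, \forall r \near +oo, A <= T r) ->
  (forall e : R, 0 < e -> \forall r \near +oo, ln (T r) <= e * r) ->
  exists E : set R, zero_upper_density E /\
    forall e : R, 0 < e -> \forall r \near pinfty_outside E,
      `|\sum_k jensen_mean (g k) r - jensen_mean (casoratian c g) r| <= e * T r.
Proof.
move=> gc /choice[C hC] T0 Tnd Tinf Tln.
(* Translations in the Casoratian have length at most [n |c|]; the added 1 makes the block length
   positive in every case. *)
pose H := n%:R * `|c| + 1.
have H0 : 0 < H by rewrite ltr_wpDl// mulr_ge0.
pose U r := T r + \sum_k jensen_mean (g k) r + 1.
have J0 k r : 0 <= r -> 0 <= jensen_mean (g k) r.
  by move=> r0; apply: jensen_mean_ge0 => //; exact: (gc k).2.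
have Jnd k r t : 0 <= r <= t -> jensen_mean (g k) r <= jensen_mean (g k) t.
  by move=> rt; apply: jensen_mean_nondecreasing => //; exact: (gc k).2.
have U1 r : 0 <= r -> 1 <= U r.
  move=> r0; rewrite /U lerDr addr_ge0 ?T0// sumr_ge0// => k _; exact: J0.
have Und r t : 0 <= r <= t -> U r <= U t.
  by move=> rt; rewrite /U lerD2r lerD ?Tnd// ler_sum// => k _; exact: Jnd.
(* One [T] from [U] itself, [n + 1] from the means, and a last one absorbing the constants. *)
pose K : R := n%:R + 3.
have K0 : 0 < K by rewrite ltr_wpDl.
have UK : \forall r \near +oo, U r <= K * T r.
  near=> r.
  have TC : \sum_k C k + 1 <= T r by near: r; exact: Tinf.
  rewrite /U; apply: (@le_trans _ _ (T r + \sum_k (T r + C k) + 1)).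
    by rewrite lerD2r lerD2l ler_sum// => k _; exact: hC.
  by rewrite big_split/= sumr_const card_ord -mulr_natl -natr1 /K; lra.
have Uln (e : R) : 0 < e -> \forall r \near +oo, ln (U r) <= e * r.
  move=> e0; have e2 : 0 < e / 2 by lra.
  near=> r.
  have r0 : 0 <= r by near: r; apply: nbhs_pinfty_ge; exact: num_real.
  have T1 : 1 <= T r by near: r; exact: Tinf.
  have Tr : ln (T r) <= e / 2 * r by near: r; exact: Tln.
  have UKr : U r <= K * T r by near: r.
  have rK : ln K / (e / 2) <= r by near: r; apply: nbhs_pinfty_ge; exact: num_real.
  have T_gt0 : 0 < T r by exact: lt_le_trans T1.
  have U_gt0 : 0 < U r by rewrite (lt_le_trans ltr01)// U1.
  have : ln (U r) <= ln (K * T r) by rewrite ler_ln ?posrE// mulr_gt0.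
  rewrite lnM ?posrE//; move: rK; rewrite ler_pdivrMr//; lra.
have [E [E0 hE]] := growth_outside_blocks H0 U1 Und Uln.
exists E; split=> // e e0.
have /choice[A hA] k := convex_translate H (gc k).2.
pose B r := 2 * (U (r + H) - U r) + \sum_k `|A k|.
pose D := `|\sum_k g k 0 - casoratian c g 0|.
have defect r : 0 <= r ->
    `|\sum_k jensen_mean (g k) r - jensen_mean (casoratian c g) r|
      <= n.+1%:R * B r + D.
  move=> r0.
  have hB k (m : nat) : (m <= n)%N ->
      `|g k (r + m%:R * c) - g k r| <= B r /\
      `|g k (- r + m%:R * c) - g k (- r)| <= B r.
    move=> mn; have mH : `|m%:R * c| <= H.
      rewrite normrM normr_nat /H -[leLHS]addr0 lerD// ler_wpM2r//.
      by rewrite ler_nat.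
    have [h1 h2] := hA k _ _ r0 mH.
    suff le : 2 * (jensen_mean (g k) (r + H) - jensen_mean (g k) r) + A k <= B r.
      by split; [exact: le_trans h1 le|exact: le_trans h2 le].
    have rH : 0 <= r <= r + H by rewrite r0 lerDl ltW.
    rewrite /B lerD//; last first.
      by rewrite (bigD1 k)//= (le_trans (ler_norm _))// lerDl sumr_ge0.
    (* The other summands of [U] have nonnegative increments, so the increment of the [k]th mean is
       at most that of [U]. *)
    rewrite ler_wpM2l// /U (bigD1 k)//= (bigD1 k (F := fun k => jensen_mean (g k) r))//=.
    have : \sum_(i < n.+1 | i != k) jensen_mean (g i) r
        <= \sum_(i < n.+1 | i != k) jensen_mean (g i) (r + H).
      by apply: ler_sum => i _; exact: Jnd.
    have := Tnd _ _ rH.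
    set s1 := \sum_(i < n.+1 | i != k) jensen_mean (g i) r.
    set s2 := \sum_(i < n.+1 | i != k) jensen_mean (g i) (r + H).
    lra.
  rewrite -jensen_mean_sum.
  by apply: jensen_mean_dist; rewrite distrC; apply: casoratian_close => k m mn;
    have [] := hB k m mn.
pose N : R := n.+1%:R.
have N0 : 0 < N by rewrite ltr0n.
(* The defect is at most [2 * N] increments of [U] plus constants; this choice turns the former into
   [e / 2 * T r] and leaves the other half for the constants. *)
have e'0 : 0 < e / (4 * N * K) by rewrite divr_gt0// !mulr_gt0.
have hU := hE _ e'0.
have UK' := near_pinfty_outside E UK.
have T' := near_pinfty_outside E (Tinf ((N * \sum_k `|A k| + D) / (e / 2))).
have r' : \forall r \near pinfty_outside E, 0 <= r.
  by apply: near_pinfty_outside; apply: nbhs_pinfty_ge; exact: num_real.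
near=> r.
have r0 : 0 <= r by near: r.
apply: (le_trans (defect r r0)).
have h1 : U (r + H) - U r <= e / (4 * N * K) * U r by near: r.
have h2 : U r <= K * T r by near: r.
have h3 : (N * \sum_k `|A k| + D) / (e / 2) <= T r by near: r.
have h4 : N * \sum_k `|A k| + D <= e / 2 * T r.
  by move: h3; rewrite ler_pdivrMr 1?mulrC//; lra.
have h5 : e / (4 * N * K) * U r <= e / (4 * N * K) * (K * T r).
  by rewrite ler_wpM2l// ltW.
have h6 : 2 * N * (e / (4 * N * K) * (K * T r)) = e / 2 * T r.
  by field; rewrite !gt_eqF.
have h7 : 2 * N * (U (r + H) - U r) <= 2 * N * (e / (4 * N * K) * (K * T r)).
  by rewrite ler_wpM2l ?mulr_ge0 ?(ltW N0)// (le_trans h1).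
rewrite h6 in h7; have -> : e * T r = e / 2 * T r + e / 2 * T r by field.
by rewrite /B -/N mulrDr -addrA mulrA (mulrC N) lerD.
Unshelve. all: by end_near. Qed.

(** Every error term of the theorem satisfies a bound of this shape, with [Delta] the Casoratian
    defect. *)
Lemma littleo_defect (R : realType) (F : filter_on R) (T Delta e : R -> R)
    (C : R) :
  (forall A : R, \forall r \near F, A <= T r) ->
  (forall d : R, 0 < d -> \forall r \near F, `|Delta r| <= d * T r) ->
  (\forall r \near F, `|e r| <= 2 * `|Delta r| + C) ->
  e =o_F T.
Proof.
move=> Tinf hD he; apply/eqoP => d d0.
have d4 : 0 < d / 4 by lra.
near=> r.
have h1 : `|e r| <= 2 * `|Delta r| + C by near: r.
have h2 : `|Delta r| <= d / 4 * T r by near: r; exact: hD.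
have h3 : C / (d / 2) <= T r by near: r; exact: Tinf.
have h4 : C <= d / 2 * T r by move: h3; rewrite ler_pdivrMr 1?mulrC//; lra.
have h5 : d * T r <= d * `|T r| by rewrite ler_wpM2l ?ler_norm// ltW.
apply: (le_trans h1); apply: le_trans h5; lra.
Unshelve. all: by end_near. Qed.

(** * Assembly of the chain from the means of the forms *)

Lemma convex_piecewise_linear_tform_comp (R : realType) (n : nat)
    (a : tcoord R n) (fr : 'I_n.+1 -> R -> R) :
  (forall k, convex_piecewise_linear (fr k)) ->
  convex_piecewise_linear (tform_comp a fr).
Proof.
move=> frc; apply: tform_comp_closed; first exact: convex_piecewise_linear_max.
move=> k; have [PL cv] := frc k; split.
  by apply: piecewise_linearD PL; exact: piecewise_linear_cst.
by apply: convex_on_lineD cv => x y t _; lra.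
Qed.

Lemma card_ord_gt (n q : nat) : #|[set j : 'I_q | (n < j)%N]%SET| = (q - n.+1)%N.
Proof.
rewrite -sum1dep_card.
by rewrite -(big_geq_mkord _ _ xpredT (fun=> 1%N)) sum_nat_const_nat muln1.
Qed.

Theorem corollary4p12 (R : realType) (n q : nat) (n_gt0 : (0 < n)%N)
    (n_lt_q : (n < q)%N) (c : R) (c_neq0 : c != 0)
    (f : R -> TP R n) (fr : 'I_n.+1 -> R -> R)
    (f_fr : reduced_representation f fr)
    (f_nondegenerate : linearly_nondegenerate f)
    (P : 'I_q -> tcoord R n) :
  let Pf := fun j : 'I_q => tform_comp (P j) fr in
  let Co := casoratian c (fun k : 'I_n.+1 => Pf (widen_ord n_lt_q k)) in
  let L := fun x : R => (\sum_(j < q) Pf j x) - Co x in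
  let T := Tchar fr in
  let lambda := ddg fr [set j : 'I_q | (n < j)%N]%SET Pf in
  limf_esup (fun r : R => (ln (T r) / r)%:E) (pinfty_nbhs R) = 0%E ->
  (exists E : set R, zero_upper_density E /\ let F := pinfty_outside E in
    exists e1 e2 e3 e4 : R -> R,
      [/\ e1 =o_F T, e2 =o_F T,
          e3 =o_F T & e4 =o_F T] /\
      \forall r \near F,
        [/\ (q%:R - n%:R - 1 - lambda%:R) * T r
              <= Ncount r (\- L) - Ncount r L + e1 r,
            Ncount r (\- L) - Ncount r L + e1 r
              = \sum_(j < q) Ncount r (\- Pf j) - Ncount r (\- Co) + e2 r,
            \sum_(j < q) Ncount r (\- Pf j) - Ncount r (\- Co) + e2 r
              <= \sum_(j < q | (n < j)%N) Ncount r (\- Pf j) + e3 r &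
            \sum_(j < q | (n < j)%N) Ncount r (\- Pf j) + e3 r
              <= (q%:R - n%:R - 1) * T r + e4 r]) /\
  (lambda = 0%N ->
   exists E : set R, zero_upper_density E /\ let F := pinfty_outside E in
    exists e1 e2 e3 : R -> R,
      [/\ e1 =o_F T, e2 =o_F T &
          e3 =o_F T] /\
      \forall r \near F,
        [/\ (q%:R - n%:R - 1) * T r
              = Ncount r (\- L) - Ncount r L + e1 r,
            Ncount r (\- L) - Ncount r L + e1 r
              = \sum_(j < q) Ncount r (\- Pf j) - Ncount r (\- Co) + e2 r &
            \sum_(j < q) Ncount r (\- Pf j) - Ncount r (\- Co) + e2 r
              = \sum_(j < q | (n < j)%N) Ncount r (\- Pf j) + e3 r]).
Proof.
move=> Pf Co L T lambda hT.
have [fr_entire _ fE] := f_fr.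
have frc k : convex_piecewise_linear (fr k).
  split; last exact: tropical_entire_convex.
  exact: tropical_meromorphic_piecewise_linear (fr_entire k).1.
have Pfc j : convex_piecewise_linear (Pf j).
  exact: convex_piecewise_linear_tform_comp.
have Coc : convex_piecewise_linear Co.
  exact: convex_piecewise_linear_casoratian.
have [gPL gc] := convex_piecewise_linear_tnorm frc.
(* [Tchar fr] unfolds to [jensen_mean (tnorm fr)], so the facts on convex means apply to [T]. *)
have T0 r : 0 <= r -> 0 <= T r by exact: jensen_mean_ge0.
have Tnd r t : 0 <= r <= t -> T r <= T t by exact: jensen_mean_nondecreasing.
have [r0 r00 Tr0] := nondegenerate_Tchar_gt0 n_gt0 frc fE f_nondegenerate.
have Tinf A : \forall r \near +oo, A <= T r.
  exact: convex_jensen_mean_pinfty Tr0.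
have Tln (e : R) : 0 < e -> \forall r \near +oo, ln (T r) <= e * r.
  move=> e0; near=> r.
  have rgt0 : 0 < r by near: r; apply: nbhs_pinfty_gt; exact: num_real.
  rewrite -ler_pdivrMr//; near: r; exact: limf_esup_pinfty_le.
pose J j r := jensen_mean (Pf j) r.
have J_le j : exists C, forall r, J j r <= T r + C.
  by apply: jensen_mean_le => x; exact: tform_comp_le_tnorm.
have J_ge0 j r : 0 <= r -> 0 <= J j r by move=> r_ge0; exact: jensen_mean_ge0 (Pfc j).2 _.
(* Completeness stands inside the quantifier so that a constant can be chosen for every [j]. *)
have J_ge j : exists C, forall r, tcomplete fr (Pf j) -> T r <= J j r + C.
  have [|nc] := boolP (tcomplete fr (Pf j)); last by exists 0.
  move=> /tcomplete_real Pfin.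
  have [C hC] := jensen_mean_le (fun x => tnorm_le_tform_comp fr x Pfin).
  by exists C => r _; exact: hC.
have [E [E0 hE]] := casoratian_defect c (fun k => Pfc (widen_ord n_lt_q k))
  (fun k => J_le (widen_ord n_lt_q k)) T0 Tnd Tinf Tln.
pose Delta r := \sum_(k < n.+1) J (widen_ord n_lt_q k) r - jensen_mean Co r.
pose S r := \sum_(j < q | (n < j)%N) J j r.
have /choice[C hC] := J_le; have /choice[D hD] := J_ge.
pose K : R := \sum_j (`|C j| + `|D j|).
have KC (Q : pred 'I_q) : \sum_(j | Q j) C j <= K.
  rewrite /K big_mkcond; apply: ler_sum => j _; have := ler_norm (C j).
  by have := normr_ge0 (C j); have := normr_ge0 (D j); case: ifP => _; lra.
have KD (Q : pred 'I_q) : \sum_(j | Q j) D j <= K.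
  rewrite /K big_mkcond; apply: ler_sum => j _; have := ler_norm (D j).
  by have := normr_ge0 (C j); have := normr_ge0 (D j); case: ifP => _; lra.
have K0 : 0 <= K by apply: sumr_ge0 => j _; exact: addr_ge0.
(* Indices start at 0, so [n < j] selects the [q - n - 1] forms [P_(n+2), ..., P_q]. *)
have mE : q%:R - n%:R - 1 = (#|[set j : 'I_q | (n < j)%N]%SET|)%:R :> R.
  by rewrite card_ord_gt natrB// -(natr1 n); ring.
have S_le r : S r <= (q%:R - n%:R - 1) * T r + K.
  apply: (@le_trans _ _ (\sum_(j < q | (n < j)%N) (T r + C j))).
    by apply: ler_sum => j _; exact: hC.
  by rewrite big_split/= mE lerD ?KC// sumr_const cardsE mulr_natl.
(* Each complete form contributes [T] up to a constant; the [lambda] others are dropped, their means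
   being nonnegative. *)
have S_ge r : 0 <= r -> (q%:R - n%:R - 1 - lambda%:R) * T r <= S r + K.
  move=> r_ge0.
  have -> : q%:R - n%:R - 1 - lambda%:R
      = (#|[set j : 'I_q | (n < j)%N & tcomplete fr (Pf j)]%SET|)%:R :> R.
    rewrite mE /lambda /ddg -(cardsID [set j | tcomplete fr (Pf j)]%SET).
    rewrite natrD; set u := #|_ :\: _|; set v := #|[set j in _ | _]%SET|.
    have -> : u = v by apply: eq_card => j; rewrite !inE andbC.
    by rewrite addrK; congr (_%:R); apply: eq_card => j; rewrite !inE.
  rewrite mulr_natl -sumr_const.
  apply: (@le_trans _ _ (\sum_(j < q | (n < j)%N && tcomplete fr (Pf j)) (J j r + D j))).
    rewrite (eq_bigl (fun j : 'I_q => (n < j)%N && tcomplete fr (Pf j))); last first.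
      by move=> j; rewrite inE.
    by apply: ler_sum => j /andP[_ Pj]; exact: hD.
  rewrite big_split/= lerD ?KD// /S big_mkcondr/=.
  by apply: ler_sum => j _; case: ifP => // _; exact: J_ge0.
have NPf j r : 0 <= r -> Ncount r (\- Pf j) = J j r.
  by move=> r_ge0; apply: Ncount_convex => //; [exact: (Pfc j).1|exact: (Pfc j).2].
have NCo r : 0 <= r -> Ncount r (\- Co) = jensen_mean Co r.
  by move=> r_ge0; apply: Ncount_convex => //; [exact: Coc.1|exact: Coc.2].
(* The first [n + 1] means join the Casoratian in [Delta]. *)
have sumJ r : \sum_(j < q) J j r - jensen_mean Co r = S r + Delta r.
  rewrite (bigID (fun j : 'I_q => (n < j)%N))/= -/(S r) /Delta addrA.
  congr (_ + _ - _); rewrite -(big_ord_narrow (F := J ^~ r) n_lt_q).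
  by apply: eq_bigl => j; rewrite -leqNgt.
have NL r : 0 <= r -> Ncount r (\- L) - Ncount r L = S r + Delta r.
  move=> r_ge0; rewrite tropical_jensen//; last first.
    apply: piecewise_linearD; last exact: piecewise_linearN Coc.1.
    by apply: piecewise_linear_sum => j _; exact: (Pfc j).1.
  by rewrite -sumJ /L jensen_meanB jensen_mean_sum.
have NPfCo r : 0 <= r ->
    \sum_(j < q) Ncount r (\- Pf j) - Ncount r (\- Co) = S r + Delta r.
  move=> r_ge0; rewrite NCo// -sumJ; congr (_ - _).
  by apply: eq_bigr => j _; exact: NPf.
have NS r : 0 <= r -> \sum_(j < q | (n < j)%N) Ncount r (\- Pf j) = S r.
  by move=> r_ge0; apply: eq_bigr => j _; exact: NPf.
have pos : \forall r \near pinfty_outside E, 0 <= r.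
  by apply: near_pinfty_outside; apply: nbhs_pinfty_ge; exact: num_real.
have TinfE A := near_pinfty_outside E (Tinf A).
pose F := pinfty_outside E.
have littleo (e : R -> R) (M : R) : (forall r, 0 <= r -> `|e r| <= 2 * `|Delta r| + M) ->
    e =o_F T.
  move=> he; apply: (@littleo_defect _ F T Delta e M TinfE hE).
  by apply: filterS pos => r; exact: he.
have dn r := normr_ge0 (Delta r).
have dle r := ler_norm (Delta r).
have dle' r : - Delta r <= `|Delta r| by rewrite -normrN ler_norm.
split.
  exists E; split=> //; rewrite -/F /=.
  (* The first link costs [K] and [- Delta]; both middle expressions are [S + Delta], so their
     errors coincide; the third link adds [|Delta|] and the last one another [K]. *)
  exists (fun r => `|Delta r| + K), (fun r => `|Delta r| + K),
    (fun r => 2 * `|Delta r| + K), (fun r => 2 * `|Delta r| + 2 * K).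
  split.
    split.
    - by apply: (littleo _ K) => r _; rewrite ger0_norm ?addr_ge0//; have := dn r; lra.
    - by apply: (littleo _ K) => r _; rewrite ger0_norm ?addr_ge0//; have := dn r; lra.
    - by apply: (littleo _ K) => r _; rewrite ger0_norm// addr_ge0// mulr_ge0.
    - by apply: (littleo _ (2 * K)) => r _; rewrite ger0_norm// addr_ge0// mulr_ge0.
  apply: filterS pos => r r_ge0; rewrite NL// NPfCo// NS//.
  split=> //.
  - by have := S_ge r r_ge0; have := dle' r; lra.
  - by have := dle r; lra.
  - by have := S_le r; lra.
move=> lambda0; exists E; split=> //; rewrite -/F /=.
(* For [lambda = 0] the sum [S] is within [K] of [(q - n - 1) T], so the exact gaps serve as errors
   and every link becomes an equality. *)
pose e r := (q%:R - n%:R - 1) * T r - (S r + Delta r).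
exists e, e, (fun r => (q%:R - n%:R - 1) * T r - S r).
have eb r : 0 <= r -> `|(q%:R - n%:R - 1) * T r - S r| <= K.
  move=> r_ge0; have := S_le r; have := S_ge r r_ge0; rewrite lambda0 subr0.
  by rewrite ler_norml => *; apply/andP; lra.
have eo : e =o_F T.
  apply: (littleo _ K) => r r_ge0; rewrite /e opprD addrA.
  by apply: (le_trans (ler_normB _ _)); have := eb r r_ge0; have := dn r; lra.
split.
  split=> //; apply: (littleo _ K) => r r_ge0.
  by have := eb r r_ge0; have := dn r; lra.
apply: filterS pos => r r_ge0; rewrite NL// NPfCo// NS// /e.
by split=> //; ring.
Unshelve. all: by end_near. Qed.
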